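(* Let $\mathcal{P}$ be a convex uniform polyhedron inscribed in the unit sphere $\mathcal{S}\subset\mathbb{R}^3$ centered at the origin. For each face $F$ of $\mathcal{P}$, let $n_F$ be its number of vertices, let $r_F\in(0,1)$ be its circumradius, let $c_F=\cos\frac{\pi}{n_F}$, and choose a real number $x_{1,F}$ with $0<x_{1,F}<c_Fr_F$. For each face $F$, let $T_F$ be the system of $3n_F$ quadratic triangular Bézier patches defined in the context with $n=n_F$, $r=r_F$, $x_1=x_{1,F}$, and let $A_F$ be a rotation of $\mathbb{R}^3$ about the origin which maps the regular $n_F$-gon with vertices $\big(r_F\cos\tfrac{(2k+1)\pi}{n_F},\,r_F\sin\tfrac{(2k+1)\pi}{n_F},\,\sqrt{1-r_F^2}\big)$, $k=0,\dots,n_F-1$, onto $F$. Then all these patches are regular (the cross product of their two first partial derivatives vanishes nowhere on $\Delta$), and the spline consisting of the patches in $A_F(T_F)$, where $F$ runs through all faces of $\mathcal{P}$, is a $G^1$ continuous spline of quadratic triangular patches over the triangulation of the boundary surface of $\mathcal{P}$ in which each $n$-gonal face is subdivided into $3n$ triangles.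
   Context: Let $\Delta=\{(\xi,\eta)\in\mathbb{R}^2: \xi,\eta\ge 0,\ \xi+\eta\le 1\}$. The quadratic triangular Bézier patch with control points $\boldsymbol{b}_{i,j,k}\in\mathbb{R}^3$, $i+j+k=2$, $i,j,k\ge0$, is the map $\Delta\to\mathbb{R}^3$, $(\xi,\eta)\mapsto\sum_{i+j+k=2}\frac{2}{i!\,j!\,k!}\xi^i\eta^j(1-\xi-\eta)^k\boldsymbol{b}_{i,j,k}$. A convex uniform polyhedron is a convex polyhedron with regular polygonal faces whose symmetry group acts transitively on its vertices (Platonic and Archimedean solids, uniform prisms and antiprisms). Triangulation: inside a regular $n$-gon with vertices $V_1,\dots,V_n$ and center $C$ one inscribes a smaller concentric regular $n$-gon with vertices $W_1,\dots,W_n$, rotated by $\pi/n$; the $3n$ triangles are $V_iV_{i+1}W_i$, $W_iW_{i+1}V_{i+1}$, $W_iW_{i+1}C$, $i=1,\dots,n$ ($V_{n+1}=V_1$, $W_{n+1}=W_1$). Definition of the system of patches for given $n\ge3$, $0<r<1$ and $0<x_1<cr$, where $c=\cos\frac{\pi}{n}$, $\sigma=\sqrt{1-c^2}$, $q=\sqrt{1-r^2}$. Put $$z_1=\tfrac{2-2crx_1+(c^2-1)r^2}{2q},\quad x_2=\tfrac{cr+x_1}{2},\quad y_2=\tfrac{r\sigma}{2},\quad x_3=c^2x_1,\quad z_3=\tfrac{2-2c^3rx_1+(c^2-1)r^2}{2q},\quad x_4=\tfrac{x_1}{2},\quad z_4=\tfrac{2-crx_1+(c^2-1)r^2}{2q}.$$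 Let $\mathcal{R}_\Sigma$ be the reflection in the plane $\Sigma:\ \sigma x+cy=0$. Let $\boldsymbol{p}_1,\boldsymbol{p}_2,\boldsymbol{p}_3$ be the quadratic triangular Bézier patches with control points $\boldsymbol{b}^m_{i,j,k}$, $m=1,2,3$: $$\boldsymbol{b}^1_{0,0,2}=(rc,-r\sigma,q),\quad \boldsymbol{b}^1_{2,0,0}=(rc,r\sigma,q),\quad \boldsymbol{b}^1_{0,2,0}=(x_1,0,z_1),\quad \boldsymbol{b}^1_{1,0,1}=\Big(\tfrac{cr}{1-(1-c^2)r^2},0,\tfrac{q}{1-(1-c^2)r^2}\Big),$$ $$\boldsymbol{b}^1_{0,1,1}=\Big(x_2,-y_2,\tfrac{1-r(cx_2+y_2\sigma)}{q}\Big),\quad \boldsymbol{b}^1_{1,1,0}=\Big(x_2,y_2,\tfrac{1-r(cx_2+y_2\sigma)}{q}\Big);$$ $$\boldsymbol{b}^2_{0,0,2}=\boldsymbol{b}^1_{0,0,2},\quad \boldsymbol{b}^2_{0,1,1}=\boldsymbol{b}^1_{0,1,1},\quad \boldsymbol{b}^2_{0,2,0}=\boldsymbol{b}^1_{0,2,0},\quad \boldsymbol{b}^2_{1,0,1}=\mathcal{R}_\Sigma(\boldsymbol{b}^1_{0,1,1}),\quad \boldsymbol{b}^2_{1,1,0}=\big(x_3,-\tfrac{\sigma}{c}x_3,z_3\big),\quad \boldsymbol{b}^2_{2,0,0}=\mathcal{R}_\Sigma(\boldsymbol{b}^1_{0,2,0});$$ $$\boldsymbol{b}^3_{0,0,2}=\boldsymbol{b}^2_{0,2,0},\quad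 \boldsymbol{b}^3_{0,1,1}=\boldsymbol{b}^2_{1,1,0},\quad \boldsymbol{b}^3_{0,2,0}=\boldsymbol{b}^2_{2,0,0},\quad \boldsymbol{b}^3_{1,0,1}=(x_4,0,z_4),\quad \boldsymbol{b}^3_{1,1,0}=\mathcal{R}_\Sigma(\boldsymbol{b}^3_{1,0,1}),\quad \boldsymbol{b}^3_{2,0,0}=(0,0,z_4).$$ The patches $\boldsymbol{p}_1,\boldsymbol{p}_2,\boldsymbol{p}_3$ correspond to the triangles $V_1W_1V_2$, $V_1W_1W_n$, $W_1CW_n$. The system consists of the $3n$ patches obtained from $\boldsymbol{p}_1,\boldsymbol{p}_2,\boldsymbol{p}_3$ by the rotations about the $z$-axis through the angles $\frac{2\pi k}{n}$, $k=0,\dots,n-1$. A spline of triangular patches is $G^1$ continuous if any two patches corresponding to triangles with a common edge (within one face or across an edge of $\mathcal{P}$) share the same boundary curve over that edge and their tangent planes (the planes spanned by the first partial derivatives) coincide at every point of that common boundary curve. *)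

(* Defs.v *)
From mathcomp Require Import all_boot all_order all_algebra.
From mathcomp Require Import all_classical all_reals all_analysis.

Set Implicit Arguments.
Unset Strict Implicit.
Unset Printing Implicit Defensive.

Import Order.TTheory GRing.Theory Num.Theory.
Import numFieldNormedType.Exports.

Local Open Scope classical_set_scope.
Local Open Scope ring_scope.

(* Points of R^3 are row vectors, so a linear map with matrix A acts by
   p |-> p *m A. The library norm on 'rV[R]_3 is the sup norm; Euclidean
   notions below go through [dot]. *)
Notation pt R := 'rV[R]_3.

Definition mkpt {R : realType} (x y z : R) : pt R :=
  \row_(j < 3) [:: x; y; z]`_j.

Definition px {R : realType} (p : pt R) : R := p ord0 (inord 0).
Definition py {R : realType} (p : pt R) : R := p ord0 (inord 1).
Definition pz {R : realType} (p : pt R) : R := p ord0 (inord 2).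

Definition dot {R : realType} (u v : pt R) : R := \sum_(j < 3) u 0 j * v 0 j.

Definition cross {R : realType} (u v : pt R) : pt R :=
  mkpt (py u * pz v - pz u * py v)
       (pz u * px v - px u * pz v)
       (px u * py v - py u * px v).

Definition conv_hull {R : realType} {m : nat} (v : 'I_m -> pt R) : set (pt R) :=
  [set p | exists w : 'I_m -> R,
     [/\ forall i, 0 <= w i, \sum_(i < m) w i = 1
       & p = \sum_(i < m) w i *: v i]].

Definition convex_polyhedron {R : realType} (P : set (pt R)) : Prop :=
  (exists (m : nat) (v : 'I_m -> pt R), P = conv_hull v) /\ P° !=set0.

Definition vertex {R : realType} (P : set (pt R)) (v : pt R) : Prop :=
  P v /\ forall (a b : pt R) (t : R), P a -> P b -> 0 < t < 1 ->
    v = (1 - t) *: a + t *: b -> a = b.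

Definition face {R : realType} (P F : set (pt R)) : Prop :=
  (exists (u : pt R) (h : R),
     [/\ u != 0, forall p, P p -> dot u p <= h
       & F = P `&` [set p | dot u p = h]]) /\
  exists a b d : pt R, [/\ F a, F b, F d & free [:: b - a; d - a]].

(* F is a regular n-gon (as a convex region) with circumradius r; (u, v) is an
   orthonormal frame of its plane and m its center. *)
Definition regular_polygon {R : realType} (n : nat) (r : R) (F : set (pt R)) :
    Prop :=
  [/\ (3 <= n)%N, 0 < r &
    exists m u v : pt R,
      [/\ dot u u = 1, dot v v = 1, dot u v = 0 &
        F = conv_hull (fun k : 'I_n =>
              m + (r * cos (2 * k%:R * pi / n%:R)) *: u
                + (r * sin (2 * k%:R * pi / n%:R)) *: v)]].

Definition isometry {R : realType} (g : pt R -> pt R) : Prop :=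
  forall p q, dot (g p - g q) (g p - g q) = dot (p - q) (p - q).

Definition convex_uniform_polyhedron {R : realType} (P : set (pt R)) : Prop :=
  [/\ convex_polyhedron P,
      forall F, face P F -> exists (n : nat) (r : R), regular_polygon n r F
    & forall v w, vertex P v -> vertex P w ->
        exists g, [/\ isometry g, g @` P = P & g v = w]].

Definition inscribed_in_unit_sphere {R : realType} (P : set (pt R)) : Prop :=
  forall v, vertex P v -> dot v v = 1.

Definition rotation {R : realType} (A : 'M[R]_3) : Prop :=
  A *m A^T = 1%:M /\ \det A = 1.

Definition Delta {R : realType} (xi eta : R) : Prop :=
  [/\ 0 <= xi, 0 <= eta & xi + eta <= 1].

(* Control points are indexed by i, j, k; only those with i + j + k = 2 matter.
   Patches are polynomial maps, hence are taken to be defined on the whole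
   plane, so that their partial derivatives make sense on the boundary of the
   parameter triangle Delta. *)
Definition bezier {R : realType} (b : nat -> nat -> nat -> pt R) (xi eta : R) :
    pt R :=
  \sum_(i < 3) \sum_(j < 3) \sum_(k < 3 | (i + j + k == 2)%N)
    (2%:R / (i`! * j`! * k`!)%:R
       * xi ^+ i * eta ^+ j * (1 - xi - eta) ^+ k) *: b i j k.

Definition quadratic_patch {R : realType} (p : R -> R -> pt R) : Prop :=
  exists b : nat -> nat -> nat -> pt R, p = bezier b.

Definition d_xi {R : realType} (p : R -> R -> pt R) (xi eta : R) : pt R :=
  derive1 (fun s : R => p s eta) xi.

Definition d_eta {R : realType} (p : R -> R -> pt R) (xi eta : R) : pt R :=
  derive1 (fun s : R => p xi s) eta.

Definition regular_patch {R : realType} (p : R -> R -> pt R) : Prop :=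
  forall xi eta, Delta xi eta -> cross (d_xi p xi eta) (d_eta p xi eta) != 0.

Definition tangent_plane {R : realType} (p : R -> R -> pt R) (xi eta : R) :
    {vspace (pt R)} :=
  <<[:: d_xi p xi eta; d_eta p xi eta]>>%VS.

(* The field v_ijk is the corner corresponding to the control point b_ijk, i.e.
   to the parameters (xi, eta) = (i / 2, j / 2). *)
Record triangle (R : realType) := Triangle {
  v002 : pt R;
  v020 : pt R;
  v200 : pt R }.

Definition corners {R : realType} (T : triangle R) : seq (pt R) :=
  [:: v002 T; v020 T; v200 T].

Definition tri_point {R : realType} (T : triangle R) (xi eta : R) : pt R :=
  xi *: v200 T + eta *: v020 T + (1 - xi - eta) *: v002 T.

(* The triangles T s and the patches p s over them are indexed by s in D.
   Whenever two triangles have a common edge [a, b], the two patches have, over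
   each point of that edge, the same value and the same tangent plane. *)
Definition G1_continuous {R : realType} {I : Type} (D : set I)
    (T : I -> triangle R) (p : I -> R -> R -> pt R) : Prop :=
  forall s t : I, D s -> D t ->
  forall a b : pt R, a != b ->
    a \in corners (T s) -> b \in corners (T s) ->
    a \in corners (T t) -> b \in corners (T t) ->
  forall (l xi eta xi' eta' : R), 0 <= l <= 1 ->
    Delta xi eta -> Delta xi' eta' ->
    tri_point (T s) xi eta = (1 - l) *: a + l *: b ->
    tri_point (T t) xi' eta' = (1 - l) *: a + l *: b ->
    p s xi eta = p t xi' eta' /\
    tangent_plane (p s) xi eta = tangent_plane (p t) xi' eta'.

Definition reflection {R : realType} (nu p : pt R) : pt R :=
  p - (2 * dot p nu / dot nu nu) *: nu.

Definition rotz {R : realType} (theta : R) (p : pt R) : pt R :=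
  mkpt (cos theta * px p - sin theta * py p)
       (sin theta * px p + cos theta * py p)
       (pz p).

Definition net {R : realType} (b002 b011 b020 b101 b110 b200 : pt R)
    (i j k : nat) : pt R :=
  match i, j, k with
  | 0, 0, 2 => b002
  | 0, 1, 1 => b011
  | 0, 2, 0 => b020
  | 1, 0, 1 => b101
  | 1, 1, 0 => b110
  | 2, 0, 0 => b200
  | _, _, _ => 0%R
  end%N.

Inductive patch_kind := Outer | Middle | Inner.

Definition base_net {R : realType} (n : nat) (r x1 : R) (m : patch_kind) :
    nat -> nat -> nat -> pt R :=
  let c := cos (pi / n%:R) in
  let sigma := Num.sqrt (1 - c ^+ 2) in
  let q := Num.sqrt (1 - r ^+ 2) in
  let z1 := (2 - 2 * c * r * x1 + (c ^+ 2 - 1) * r ^+ 2) / (2 * q) in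
  let x2 := (c * r + x1) / 2 in
  let y2 := r * sigma / 2 in
  let x3 := c ^+ 2 * x1 in
  let z3 := (2 - 2 * c ^+ 3 * r * x1 + (c ^+ 2 - 1) * r ^+ 2) / (2 * q) in
  let x4 := x1 / 2 in
  let z4 := (2 - c * r * x1 + (c ^+ 2 - 1) * r ^+ 2) / (2 * q) in
  let R_Sigma := reflection (mkpt sigma c 0) in
  let b1_002 := mkpt (r * c) (- (r * sigma)) q in
  let b1_200 := mkpt (r * c) (r * sigma) q in
  let b1_020 := mkpt x1 0 z1 in
  let b1_101 := mkpt (c * r / (1 - (1 - c ^+ 2) * r ^+ 2)) 0
                     (q / (1 - (1 - c ^+ 2) * r ^+ 2)) in
  let b1_011 := mkpt x2 (- y2) ((1 - r * (c * x2 + y2 * sigma)) / q) in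
  let b1_110 := mkpt x2 y2 ((1 - r * (c * x2 + y2 * sigma)) / q) in
  let b2_002 := b1_002 in
  let b2_011 := b1_011 in
  let b2_020 := b1_020 in
  let b2_101 := R_Sigma b1_011 in
  let b2_110 := mkpt x3 (- (sigma / c * x3)) z3 in
  let b2_200 := R_Sigma b1_020 in
  let b3_002 := b2_020 in
  let b3_011 := b2_110 in
  let b3_020 := b2_200 in
  let b3_101 := mkpt x4 0 z4 in
  let b3_110 := R_Sigma b3_101 in
  let b3_200 := mkpt 0 0 z4 in
  match m with
  | Outer => net b1_002 b1_011 b1_020 b1_101 b1_110 b1_200
  | Middle => net b2_002 b2_011 b2_020 b2_101 b2_110 b2_200
  | Inner => net b3_002 b3_011 b3_020 b3_101 b3_110 b3_200
  end.

Definition patch {R : realType} (n : nat) (r x1 : R) (m : patch_kind)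
    (k : nat) (xi eta : R) : pt R :=
  rotz (2 * pi * k%:R / n%:R) (bezier (base_net n r x1 m) xi eta).

Definition polyV {R : realType} (n : nat) (r : R) (k : nat) : pt R :=
  mkpt (r * cos ((2 * k + 1)%:R * pi / n%:R))
       (r * sin ((2 * k + 1)%:R * pi / n%:R))
       (Num.sqrt (1 - r ^+ 2)).

Definition reference_polygon {R : realType} (n : nat) (r : R) : set (pt R) :=
  conv_hull (fun k : 'I_n => polyV n r k).

Definition polyW {R : realType} (n : nat) (r rho : R) (k : nat) : pt R :=
  mkpt (rho * cos ((2 * k)%:R * pi / n%:R))
       (rho * sin ((2 * k)%:R * pi / n%:R))
       (Num.sqrt (1 - r ^+ 2)).

Definition polyC {R : realType} (r : R) : pt R :=
  mkpt 0 0 (Num.sqrt (1 - r ^+ 2)).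

(* Indices of vertices are cyclic: k + n.-1 stands for k - 1. In particular the
   first vertex of the triangle (Outer, 0), namely polyV n r n.-1, is at the
   angle - pi / n, as is the control point b_002 of the first base patch. *)
Definition ref_triangle {R : realType} (n : nat) (r rho : R) (m : patch_kind)
    (k : nat) : triangle R :=
  let V := polyV n r in
  let W := polyW n r rho in
  match m with
  | Outer =>
      {| v002 := V (k + n.-1)%N; v020 := W k; v200 := V k |}
  | Middle =>
      {| v002 := V (k + n.-1)%N; v020 := W k; v200 := W (k + n.-1)%N |}
  | Inner =>
      {| v002 := W k; v020 := W (k + n.-1)%N; v200 := polyC r |}
  end.

Definition move_triangle {R : realType} (A : 'M[R]_3) (T : triangle R) :
    triangle R :=
  {| v002 := v002 T *m A; v020 := v020 T *m A; v200 := v200 T *m A |}.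

(* (F, m, k) stands for the k-th triangle (or patch) of kind m of the face F. *)
Definition patch_index (R : realType) := (set (pt R) * patch_kind * nat)%type.

Definition patch_indices {R : realType} (P : set (pt R)) (n : set (pt R) -> nat) :
    set (patch_index R) :=
  [set s | let: (F, _, k) := s in face P F /\ (k < n F)%N].

Definition poly_triangle {R : realType} (n : set (pt R) -> nat)
    (r rho : set (pt R) -> R) (A : set (pt R) -> 'M[R]_3) (s : patch_index R) :
    triangle R :=
  let: (F, m, k) := s in
  move_triangle (A F) (ref_triangle (n F) (r F) (rho F) m k).

Definition poly_patch {R : realType} (n : set (pt R) -> nat)
    (r x1 : set (pt R) -> R) (A : set (pt R) -> 'M[R]_3) (s : patch_index R) :
    R -> R -> pt R :=
  let: (F, m, k) := s in
  fun xi eta => patch (n F) (r F) (x1 F) m k xi eta *m A F.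

(* Main.v *)
Require Import Defs.
From mathcomp Require Import all_boot all_order all_algebra.
From mathcomp Require Import all_classical all_reals all_analysis.
From mathcomp Require Import ring lra.

Import Order.TTheory GRing.Theory Num.Theory.
Import numFieldNormedType.Exports.

Local Open Scope classical_set_scope.
Local Open Scope ring_scope.

(* Give the corners V, W, C of the triangulation the normal directions V, M, C,
   where M is the midpoint of the side of the polygon next to W, and interpolate
   linearly along the edges. The patches are tangent to this field along every
   edge. The field and the boundary curve of a patch over an edge inside a face
   depend only on the two corners of the edge. Over a side [a, b] of the polygon
   the normal is (1 - l) a + l b and the middle control point is
   2 (a + b) / |a + b|^2, so that both depend on a and b alone and are shared by
   the two adjacent faces. The corners W and C are interior to their face, so
   that distinct faces have only corners V in common. Regularity can be read off
   the projection to the plane of the face, which is affine for the middle and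
   the inner patches and differs from an affine map only by an outward shift of
   one control point for the outer ones. *)

Set Implicit Arguments.
Unset Strict Implicit.
Unset Printing Implicit Defensive.

(** * Euclidean geometry in coordinates *)

(** Serves to prove an equation modulo hypotheses: the difference of the sides is exhibited as an
    explicit combination [k], which vanishes by assumption. *)
Lemma eq_sub0 (R : zmodType) (k x y : R) : k = 0 -> x - y = k -> x = y.
Proof. by move=> -> /subr0_eq. Qed.

Lemma px_mkpt (R : realType) (x y z : R) : px (mkpt x y z) = x.
Proof. by rewrite /px mxE inordK. Qed.

Lemma py_mkpt (R : realType) (x y z : R) : py (mkpt x y z) = y.
Proof. by rewrite /py mxE inordK. Qed.

Lemma pz_mkpt (R : realType) (x y z : R) : pz (mkpt x y z) = z.
Proof. by rewrite /pz mxE inordK. Qed.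

Lemma pxD (R : realType) (u v : pt R) : px (u + v) = px u + px v.
Proof. by rewrite /px mxE. Qed.

Lemma pyD (R : realType) (u v : pt R) : py (u + v) = py u + py v.
Proof. by rewrite /py mxE. Qed.

Lemma pzD (R : realType) (u v : pt R) : pz (u + v) = pz u + pz v.
Proof. by rewrite /pz mxE. Qed.

Lemma pxN (R : realType) (u : pt R) : px (- u) = - px u.
Proof. by rewrite /px mxE. Qed.

Lemma pyN (R : realType) (u : pt R) : py (- u) = - py u.
Proof. by rewrite /py mxE. Qed.

Lemma pzN (R : realType) (u : pt R) : pz (- u) = - pz u.
Proof. by rewrite /pz mxE. Qed.

Lemma pxZ (R : realType) (a : R) (u : pt R) : px (a *: u) = a * px u.
Proof. by rewrite /px mxE. Qed.

Lemma pyZ (R : realType) (a : R) (u : pt R) : py (a *: u) = a * py u.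
Proof. by rewrite /py mxE. Qed.

Lemma pzZ (R : realType) (a : R) (u : pt R) : pz (a *: u) = a * pz u.
Proof. by rewrite /pz mxE. Qed.

Lemma px0 (R : realType) : px (0 : pt R) = 0.
Proof. by rewrite /px mxE. Qed.

Lemma py0 (R : realType) : py (0 : pt R) = 0.
Proof. by rewrite /py mxE. Qed.

Lemma pz0 (R : realType) : pz (0 : pt R) = 0.
Proof. by rewrite /pz mxE. Qed.

Lemma dotE (R : realType) (u v : pt R) :
  dot u v = px u * px v + py u * py v + pz u * pz v.
Proof.
rewrite /dot !big_ord_recl big_ord0 addr0 addrA /px /py /pz.
have -> : inord 0 = ord0 :> 'I_3 by apply/val_inj; rewrite /= inordK.
have -> : inord 1 = lift ord0 ord0 :> 'I_3 by apply/val_inj; rewrite /= inordK.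
suff -> : inord 2 = lift ord0 (lift ord0 ord0) :> 'I_3 by [].
by apply/val_inj; rewrite /= inordK.
Qed.

Lemma pt_eqP (R : realType) (u v : pt R) :
  px u = px v -> py u = py v -> pz u = pz v -> u = v.
Proof.
move=> ex ey ez; apply/rowP => -[[|[|[|//]]] lt_i3].
- by move: ex; rewrite /px (_ : inord 0 = Ordinal lt_i3)//;
    apply/val_inj; rewrite /= inordK.
- by move: ey; rewrite /py (_ : inord 1 = Ordinal lt_i3)//;
    apply/val_inj; rewrite /= inordK.
- by move: ez; rewrite /pz (_ : inord 2 = Ordinal lt_i3)//;
    apply/val_inj; rewrite /= inordK.
Qed.

Definition coordE := (px_mkpt, py_mkpt, pz_mkpt, pxD, pyD, pzD, pxN, pyN, pzN,
  pxZ, pyZ, pzZ, px0, py0, pz0).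

Lemma dotDl (R : realType) (u v w : pt R) : dot (u + v) w = dot u w + dot v w.
Proof. by rewrite !dotE !coordE; ring. Qed.

Lemma dotDr (R : realType) (u v w : pt R) : dot w (u + v) = dot w u + dot w v.
Proof. by rewrite !dotE !coordE; ring. Qed.

Lemma dotBr (R : realType) (u v w : pt R) : dot w (u - v) = dot w u - dot w v.
Proof. by rewrite !dotE !coordE; ring. Qed.

Lemma dotZl (R : realType) (a : R) (u v : pt R) : dot (a *: u) v = a * dot u v.
Proof. by rewrite !dotE !coordE; ring. Qed.

Lemma dotZr (R : realType) (a : R) (u v : pt R) : dot u (a *: v) = a * dot u v.
Proof. by rewrite !dotE !coordE; ring. Qed.

Lemma dot_sumr (R : realType) (I : finType) (u : pt R) (f : I -> pt R) :
  dot u (\sum_i f i) = \sum_i dot u (f i).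
Proof.
elim/big_rec2: _ => [|i x y _ <-]; last by rewrite dotDr.
by rewrite dotE !coordE; ring.
Qed.

Lemma dot_eq0 (R : realType) (u : pt R) : (dot u u == 0) = (u == 0).
Proof.
apply/eqP/eqP=> [|->]; last by rewrite dotE !coordE; ring.
rewrite dotE => u0.
have ux : px u = 0 by nra.
have uy : py u = 0 by nra.
have uz : pz u = 0 by nra.
by apply: pt_eqP; rewrite coordE.
Qed.

Lemma dot_mxE (R : realType) (u v : pt R) : dot u v = (u *m v^T) 0 0.
Proof. by rewrite !mxE; apply: eq_bigr => j _; rewrite mxE. Qed.

Lemma dot_mulmx (R : realType) (B : 'M[R]_3) (u v : pt R) :
  B *m B^T = 1%:M -> dot (u *m B) (v *m B) = dot u v.
Proof.
by move=> BBT; rewrite !dot_mxE trmx_mul mulmxA -(mulmxA u) BBT mulmx1.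
Qed.

Lemma mulmx_orth_inj (R : realType) (B : 'M[R]_3) :
  B *m B^T = 1%:M -> injective (fun p : pt R => p *m B).
Proof.
move=> BBT p p' /(congr1 (fun x => x *m B^T)).
by rewrite -!mulmxA BBT !mulmx1.
Qed.

Lemma lagrange_identity (R : realType) (u v : pt R) :
  dot (cross u v) (cross u v) = dot u u * dot v v - dot u v ^+ 2.
Proof. by rewrite !dotE /cross !coordE; ring. Qed.

(** By Lagrange's identity the squared length of a cross product depends on dot products only, and
    these are preserved by orthogonal matrices. *)
Lemma cross_mulmx_neq0 (R : realType) (B : 'M[R]_3) (u v : pt R) :
  B *m B^T = 1%:M -> cross u v != 0 -> cross (u *m B) (v *m B) != 0.
Proof.
by move=> BBT; rewrite -!dot_eq0 !lagrange_identity !dot_mulmx.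
Qed.

Lemma free_cross (R : realType) (u v : pt R) :
  free [:: u; v] -> cross u v != 0.
Proof.
rewrite free_cons seq1_free span_seq1 => /andP[uNv v0].
(* If $u\times v=0$, then $u$ equals its orthogonal projection to the line of $v$, because $(v\cdot
   v)u-(u\cdot v)v=v\times(u\times v)$. The three final identities are the coordinates of this
   formula. *)
apply: contra uNv => /eqP uv0; apply/vlineP; exists (dot u v / dot v v).
have vv0 : dot v v != 0 by rewrite dot_eq0.
apply: (scalerI vv0); rewrite scalerA mulrCA divff // mulr1.
have ex : px (cross u v) = 0 by rewrite uv0 coordE.
have ey : py (cross u v) = 0 by rewrite uv0 coordE.
have ez : pz (cross u v) = 0 by rewrite uv0 coordE.
move: ex ey ez; rewrite /cross !coordE.
set ex := _ - _ => x0; set ey := _ - _ => y0; set ez := _ - _ => z0.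
apply: pt_eqP; rewrite !dotE !coordE.
- by apply: (@eq_sub0 _ (py v * ez - pz v * ey)); [rewrite y0 z0 | rewrite /ez /ey]; ring.
- by apply: (@eq_sub0 _ (pz v * ex - px v * ez)); [rewrite x0 z0 | rewrite /ex /ez]; ring.
- by apply: (@eq_sub0 _ (px v * ey - py v * ex)); [rewrite x0 y0 | rewrite /ex /ey]; ring.
Qed.

Lemma span2_orthogonal (R : realType) (N u v w : pt R) :
  N != 0 -> cross u v != 0 -> dot u N = 0 -> dot v N = 0 ->
  (w \in <<[:: u; v]>>%VS) = (dot w N == 0).
Proof.
move=> N0 uv0 uN vN; apply/idP/eqP => [|wN].
  rewrite span_cons span_seq1 => /memv_addP[x /vlineP[a ->]] [y /vlineP[b ->] ->].
  by rewrite dotDl !dotZl uN vN !mulr0 addr0.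
pose det := dot (cross u v) w.
have detN : det *: N = 0.
  (* The expansion $\det(u,v,w)N=(u\cdot N)\,v\times w+(v\cdot N)\,w\times u+(w\cdot N)\,u\times v$,
     whose terms all vanish here. *)
  transitivity (dot u N *: cross v w + dot v N *: cross w u + dot w N *: cross u v).
    by apply: pt_eqP; rewrite /det /cross !dotE !coordE; ring.
  by rewrite uN vN wN !scale0r !addr0.
have det0 : det = 0 by move/eqP: detN; rewrite scaler_eq0 (negPf N0) orbF => /eqP.
have k0 : dot (cross u v) (cross u v) != 0 by rewrite dot_eq0.
(* Cramer's rule in the plane of [u] and [v]. For general [w] the right-hand side lacks the term
   [det *: cross u v], which is zero here and is put back before comparing coordinates. *)
have -> : w = (dot (cross u v) (cross u v))^-1 *:
    (dot (cross w v) (cross u v) *: u + dot (cross u w) (cross u v) *: v).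
  apply: (scalerI k0); rewrite scalerA divff // scale1r.
  rewrite -[RHS]addr0 -(scale0r (cross u v)) -det0.
  by apply: pt_eqP; rewrite /det !dotE /cross !coordE; ring.
by rewrite memvZ // memvD // memvZ // memv_span // !inE eqxx ?orbT.
Qed.

(** * Quadratic patches *)

Lemma derive1_quadratic (R : realType) (f : R -> pt R) (a b c : pt R) (x : R) :
  (forall s, f s = a + s *: b + s ^+ 2 *: c) -> derive1 f x = b + (2 * x) *: c.
Proof.
move=> fE; have {f fE} -> : f = fun s => a + s *: b + s ^+ 2 *: c.
  by apply/funext.
(* The derivative is taken entrywise, each entry being a polynomial function. *)
have entry i j : is_derive x 1 (fun s : R => (a + s *: b + s ^+ 2 *: c) i j)
    (b i j + (2 * x) * c i j).
  pose p : {poly R} := (a i j)%:P + (b i j) *: 'X + (c i j) *: 'X^2.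
  have -> : (fun s : R => (a + s *: b + s ^+ 2 *: c) i j) = horner p.
    by apply/funext => s; rewrite !mxE /p !hornerE /=; ring.
  apply: (is_derive_eq (is_derive_poly p x)).
  by rewrite /p !derivD derivC !derivZ derivX derivXn /= !hornerE /=; ring.
rewrite derive1E derive_mx; last by apply/derivable_mxP => i j; exact: ex_derive.
by apply/matrixP => i j; rewrite !mxE (@derive_val _ _ _ _ _ _ _ (entry i j)).
Qed.

Lemma bezierE (R : realType) (b : nat -> nat -> nat -> pt R) (xi eta : R) :
  bezier b xi eta =
    (1 - xi - eta) ^+ 2 *: b 0 0 2 + (2 * eta * (1 - xi - eta)) *: b 0 1 1
    + eta ^+ 2 *: b 0 2 0 + (2 * xi * (1 - xi - eta)) *: b 1 0 1
    + (2 * xi * eta) *: b 1 1 0 + xi ^+ 2 *: b 2 0 0.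
Proof.
rewrite /bezier; under eq_bigr do under eq_bigr do rewrite big_mkcond.
do 2 rewrite !big_ord_recl !big_ord0 /=.
rewrite /bump /= !addn0 !addn1 !factS !fact0 /= !muln1 !mul1n.
by apply: pt_eqP; rewrite !coordE; field.
Qed.

Lemma d_xi_bezier (R : realType) (b : nat -> nat -> nat -> pt R) (xi eta : R) :
  d_xi (bezier b) xi eta =
    (2 * (1 - xi - eta)) *: (b 1 0 1 - b 0 0 2)
    + (2 * eta) *: (b 1 1 0 - b 0 1 1) + (2 * xi) *: (b 2 0 0 - b 1 0 1).
Proof.
(* The patch is regrouped by powers of [xi]. *)
rewrite /d_xi (@derive1_quadratic _ _
  ((1 - eta) ^+ 2 *: b 0 0 2 + (2 * eta * (1 - eta)) *: b 0 1 1
   + eta ^+ 2 *: b 0 2 0)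
  ((2 * (1 - eta)) *: (b 1 0 1 - b 0 0 2) + (2 * eta) *: (b 1 1 0 - b 0 1 1))
  (b 0 0 2 - 2 *: b 1 0 1 + b 2 0 0)).
  by apply: pt_eqP; rewrite !coordE; ring.
by move=> s; rewrite bezierE; apply: pt_eqP; rewrite !coordE; ring.
Qed.

Lemma d_eta_bezier (R : realType) (b : nat -> nat -> nat -> pt R) (xi eta : R) :
  d_eta (bezier b) xi eta =
    (2 * (1 - xi - eta)) *: (b 0 1 1 - b 0 0 2)
    + (2 * eta) *: (b 0 2 0 - b 0 1 1) + (2 * xi) *: (b 1 1 0 - b 1 0 1).
Proof.
rewrite /d_eta (@derive1_quadratic _ _
  ((1 - xi) ^+ 2 *: b 0 0 2 + (2 * xi * (1 - xi)) *: b 1 0 1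
   + xi ^+ 2 *: b 2 0 0)
  ((2 * (1 - xi)) *: (b 0 1 1 - b 0 0 2) + (2 * xi) *: (b 1 1 0 - b 1 0 1))
  (b 0 0 2 - 2 *: b 0 1 1 + b 0 2 0)).
  by apply: pt_eqP; rewrite !coordE; ring.
by move=> s; rewrite bezierE; apply: pt_eqP; rewrite !coordE; ring.
Qed.

Lemma bezier_mulmx (R : realType) (b : nat -> nat -> nat -> pt R)
    (B : 'M[R]_3) (xi eta : R) :
  bezier b xi eta *m B = bezier (fun i j k => b i j k *m B) xi eta.
Proof. by rewrite !bezierE !mulmxDl -!scalemxAl. Qed.

Lemma d_xi_mulmx (R : realType) (b : nat -> nat -> nat -> pt R)
    (B : 'M[R]_3) (xi eta : R) :
  d_xi (fun s t => bezier b s t *m B) xi eta = d_xi (bezier b) xi eta *m B.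
Proof.
have -> : (fun s t => bezier b s t *m B) = bezier (fun i j k => b i j k *m B).
  by apply/funext => s; apply/funext => t; exact: bezier_mulmx.
by rewrite !d_xi_bezier !mulmxDl -!scalemxAl !mulmxBl.
Qed.

Lemma d_eta_mulmx (R : realType) (b : nat -> nat -> nat -> pt R)
    (B : 'M[R]_3) (xi eta : R) :
  d_eta (fun s t => bezier b s t *m B) xi eta = d_eta (bezier b) xi eta *m B.
Proof.
have -> : (fun s t => bezier b s t *m B) = bezier (fun i j k => b i j k *m B).
  by apply/funext => s; apply/funext => t; exact: bezier_mulmx.
by rewrite !d_eta_bezier !mulmxDl -!scalemxAl !mulmxBl.
Qed.

(** * Sites: the corners of the triangulation *)

(** A corner is recorded by its kind and its direction $(u,v)$ from the axis, not by a point. All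
    data of an edge then become functions of its two end sites, whichever triangle the edge is seen
    from. *)
Inductive site (R : Type) := SiteV of R & R | SiteW of R & R | SiteC.
Arguments SiteC {R}.

Definition site_point {R : realType} (r rho : R) (s : site R) : pt R :=
  let q := Num.sqrt (1 - r ^+ 2) in
  match s with
  | SiteV u v => mkpt (r * u) (r * v) q
  | SiteW u v => mkpt (rho * u) (rho * v) q
  | SiteC => mkpt 0 0 q
  end.

(** The control points at the corners of the triangles; the third coordinates at W and C are $z_1$
    and $z_4$. *)
Definition site_node {R : realType} (c r x1 : R) (s : site R) : pt R :=
  let q := Num.sqrt (1 - r ^+ 2) in
  match s with
  | SiteV u v => mkpt (r * u) (r * v) q
  | SiteW u v => mkpt (x1 * u) (x1 * v)
      ((2 - 2 * c * r * x1 + (c ^+ 2 - 1) * r ^+ 2) / (2 * q))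
  | SiteC => mkpt 0 0 ((2 - c * r * x1 + (c ^+ 2 - 1) * r ^+ 2) / (2 * q))
  end.

(* Only the pairs of sites joined by an edge of the triangulation matter. *)
Definition site_mid {R : realType} (c r x1 : R) (s t : site R) : pt R :=
  let q := Num.sqrt (1 - r ^+ 2) in
  let w := site_node c r x1 s + site_node c r x1 t in
  match s, t with
  | SiteV _ _, SiteV _ _ => (2 / dot w w) *: w
  | SiteV _ _, SiteW _ _ | SiteW _ _, SiteV _ _ =>
      mkpt (px w / 2) (py w / 2) ((2 - c * r * x1 - r ^+ 2) / (2 * q))
  | SiteW _ _, SiteW _ _ =>
      mkpt (px w / 2) (py w / 2)
        ((2 - 2 * c ^+ 3 * r * x1 + (c ^+ 2 - 1) * r ^+ 2) / (2 * q))
  | _, _ =>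
      mkpt (px w / 2) (py w / 2)
        ((2 - c * r * x1 + (c ^+ 2 - 1) * r ^+ 2) / (2 * q))
  end.

Definition site_net {R : realType} (c r x1 : R) (s : site R * site R * site R) :
    nat -> nat -> nat -> pt R :=
  let: (s002, s020, s200) := s in
  let b := site_node c r x1 in
  let e := site_mid c r x1 in
  net (b s002) (e s002 s020) (b s020) (e s002 s200) (e s020 s200) (b s200).

Definition site_curve {R : realType} (c r x1 : R) (s t : site R) (l : R) : pt R :=
  (1 - l) ^+ 2 *: site_node c r x1 s + (2 * l * (1 - l)) *: site_mid c r x1 s t
  + l ^+ 2 *: site_node c r x1 t.

(* The normal direction of the spline at V, W and C is V, the midpoint of the
   adjacent side of the polygon and C; it varies linearly along every edge. *)
Definition site_normal {R : realType} (c r : R) (s t : site R) (l : R) : pt R :=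
  (1 - l) *: site_point r (c * r) s + l *: site_point r (c * r) t.

(** With $c=\cos\frac{\pi}{n}$ and $\sigma=\sin\frac{\pi}{n}$, the pair $(c^2-\sigma^2,-2c\sigma)$
    is the direction at the angle $-\frac{2\pi}{n}$, the image of $(1,0)$ under the reflection in
    $\Sigma$. *)
Definition base_sites {R : realType} (c sigma : R) (m : patch_kind) :
    site R * site R * site R :=
  match m with
  | Outer => (SiteV c (- sigma), SiteW 1 0, SiteV c sigma)
  | Middle => (SiteV c (- sigma), SiteW 1 0,
               SiteW (c ^+ 2 - sigma ^+ 2) (- (2 * c * sigma)))
  | Inner => (SiteW 1 0, SiteW (c ^+ 2 - sigma ^+ 2) (- (2 * c * sigma)), SiteC)
  end.

(** Each control point of the given nets belongs to a corner or to an edge; in this form patches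
    with a common edge visibly share its control points. *)
Lemma base_net_sites (R : realType) (n : nat) (r x1 c sigma : R) (m : patch_kind) :
  c = cos (pi / n%:R) -> 0 < c -> 0 < sigma -> c ^+ 2 + sigma ^+ 2 = 1 ->
  0 < r < 1 ->
  base_net n r x1 m = site_net c r x1 (base_sites c sigma m).
Proof.
move=> cE c0 s0 cs /andP[r0 r1].
have sE : Num.sqrt (1 - c ^+ 2) = sigma.
  by rewrite (_ : 1 - c ^+ 2 = sigma ^+ 2) ?sqrtr_sqr ?gtr0_norm//; lra.
rewrite /base_net -cE sE /site_net.
have q2 : Num.sqrt (1 - r ^+ 2) ^+ 2 = 1 - r ^+ 2 by rewrite sqr_sqrtr//; nra.
have q0 : 0 < Num.sqrt (1 - r ^+ 2) by rewrite sqrtr_gt0; nra.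
have qN0 := lt0r_neq0 q0.
have c2 : c ^+ 2 = 1 - sigma ^+ 2 by lra.
have cN0 := lt0r_neq0 c0.
have D0 : 1 - sigma ^+ 2 * r ^+ 2 != 0 by rewrite lt0r_neq0//; nra.
(* The squared length of the sum of two adjacent vertices V, the denominator in the middle control
   point over a side. *)
have D2 : (r * c + r * c) * (r * c + r * c) +
    (- (r * sigma) + r * sigma) * (- (r * sigma) + r * sigma) +
    (Num.sqrt (1 - r ^+ 2) + Num.sqrt (1 - r ^+ 2)) *
    (Num.sqrt (1 - r ^+ 2) + Num.sqrt (1 - r ^+ 2)) =
    4 * (1 - sigma ^+ 2 * r ^+ 2).
  by ring: c2 q2.
have D3 : 1 - (1 - c ^+ 2) * r ^+ 2 = 1 - sigma ^+ 2 * r ^+ 2 by ring: c2.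
have D1 : 1 - (1 - c ^+ 2) * r ^+ 2 != 0 by rewrite D3.
have D4 : sigma * sigma + c * c + 0 * 0 = 1 by ring: c2.
case: m; rewrite /= /reflection; congr net; apply: pt_eqP;
  rewrite ?dotE !coordE ?mulrN ?D2 ?D3 ?D4.
(* Rational identities modulo $c^2=1-\sigma^2$ and $q^2=1-r^2$; in the last ones the denominator
   $1-\sigma^2r^2$ is treated as an indeterminate. *)
all: move: q2 qN0; clear -D0 c2 cN0.
all: move: (Num.sqrt (1 - r ^+ 2)) => q q2 qN0.
all: try by field.
all: try by field: c2.
all: try by field: q2.
all: try by field: c2 q2.
all: by move: (1 - sigma ^+ 2 * r ^+ 2) D0 => D D0; field.
Qed.

Lemma site_mid_sym (R : realType) (c r x1 : R) (s t : site R) :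
  site_mid c r x1 s t = site_mid c r x1 t s.
Proof. by case: s => [? ?|? ?|]; case: t => [? ?|? ?|]; rewrite /site_mid addrC. Qed.

(** * Regularity and edge normals of the base patches *)

(** The third component of the cross product is the Jacobian determinant of the patch projected to
    the plane of the face. It is a nonzero constant for the middle and inner patches, and a positive
    constant plus a nonnegative term for the outer ones. *)
Lemma base_sites_regular (R : realType) (c sigma r x1 : R) (m : patch_kind) :
  0 < c -> 0 < sigma -> c ^+ 2 + sigma ^+ 2 = 1 -> 0 < r < 1 -> 0 < x1 < c * r ->
  regular_patch (bezier (site_net c r x1 (base_sites c sigma m))).
Proof.
move=> c0 s0 cs /andP[r0 r1] /andP[x0 x1cr] xi eta [xi0 eta0 xieta].
suff h : pz (cross (d_xi (bezier (site_net c r x1 (base_sites c sigma m))) xi eta)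
    (d_eta (bezier (site_net c r x1 (base_sites c sigma m))) xi eta)) != 0.
  by apply: contraNneq h => ->; rewrite coordE.
have q2 : Num.sqrt (1 - r ^+ 2) ^+ 2 = 1 - r ^+ 2 by rewrite sqr_sqrtr//; nra.
have s2 : sigma ^+ 2 = 1 - c ^+ 2 by lra.
pose D := 1 - sigma ^+ 2 * r ^+ 2.
have D0 : 0 < D by rewrite /D; nra.
rewrite d_xi_bezier d_eta_bezier /cross coordE.
case: m; rewrite /= ?dotE !coordE.
- have -> : (r * c + r * c) * (r * c + r * c) +
    (r * - sigma + r * sigma) * (r * - sigma + r * sigma) +
    (Num.sqrt (1 - r ^+ 2) + Num.sqrt (1 - r ^+ 2)) *
    (Num.sqrt (1 - r ^+ 2) + Num.sqrt (1 - r ^+ 2)) = 4 * D.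
    by rewrite /D; ring: q2 s2.
  have -> : 2 / (4 * D) = (2 * D)^-1 by field; rewrite lt0r_neq0.
  (* The factor [r * c / D - r * c] is the outward shift of the middle control point from the
     midpoint of the side; it is nonnegative since $0<D\le 1$. *)
  rewrite (_ : _ - _ = 2 * r * sigma * (r * c - x1)
      + 2 * (r * c / D - r * c) * (r * sigma) * (1 - eta)); last first.
    by field; rewrite lt0r_neq0.
  apply: lt0r_neq0; apply: ltr_wpDr; last by rewrite !mulr_gt0// subr_gt0 mulrC.
  rewrite !mulr_ge0 ?mulr_gt0 ?subr_ge0 ?(ltW r0) ?(ltW s0)//; last by lra.
  by rewrite ler_pdivlMr// ger_pMr ?mulr_gt0// /D gerBl mulr_ge0// sqr_ge0.
(* Negative: the corners of a middle triangle are listed in the opposite orientation. *)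
- rewrite (_ : _ - _ = 2 * x1 * sigma * (x1 * c - r)); last first.
    by field: s2.
  apply: mulf_neq0; first by rewrite lt0r_neq0// !mulr_gt0.
  by rewrite ltr0_neq0// subr_lt0; nra.
- rewrite (_ : _ - _ = x1 ^+ 2 * (2 * c * sigma)); last by field.
  by rewrite lt0r_neq0// !mulr_gt0.
Qed.

(** The tangency that the heights of the control points secure: along each edge both derivatives are
    orthogonal to the linear interpolation of the corner normals. *)
Lemma base_sites_seam (R : realType) (c sigma r x1 xi eta : R) (m : patch_kind) :
  0 < r < 1 -> 0 < c -> 0 < sigma -> c ^+ 2 + sigma ^+ 2 = 1 ->
  [\/ 1 - xi - eta = 0, eta = 0 | xi = 0] ->
  let S := base_sites c sigma m in
  let b := bezier (site_net c r x1 S) in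
  let N := (1 - xi - eta) *: site_point r (c * r) S.1.1
    + eta *: site_point r (c * r) S.1.2 + xi *: site_point r (c * r) S.2 in
  dot (d_xi b xi eta) N = 0 /\ dot (d_eta b xi eta) N = 0.
Proof.
move=> /andP[r0 r1] c0 s0 cs seam.
have q2 : Num.sqrt (1 - r ^+ 2) ^+ 2 = 1 - r ^+ 2 by rewrite sqr_sqrtr//; nra.
have q0 : 0 < Num.sqrt (1 - r ^+ 2) by rewrite sqrtr_gt0; nra.
have s2 : sigma ^+ 2 = 1 - c ^+ 2 by lra.
have D0 : 1 - sigma ^+ 2 * r ^+ 2 != 0 by rewrite lt0r_neq0//; nra.
have qN0 := lt0r_neq0 q0.
have D2 : (r * c + r * c) * (r * c + r * c) +
    (r * - sigma + r * sigma) * (r * - sigma + r * sigma) +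
    (Num.sqrt (1 - r ^+ 2) + Num.sqrt (1 - r ^+ 2)) *
    (Num.sqrt (1 - r ^+ 2) + Num.sqrt (1 - r ^+ 2)) = 4 * (1 - sigma ^+ 2 * r ^+ 2).
  by ring: q2 s2.
case: m => /=; rewrite d_xi_bezier d_eta_bezier /= !dotE !coordE ?D2; split.
all: move: q2 qN0 D0; clear -s2 seam.
all: move: (Num.sqrt (1 - r ^+ 2)) => q q2 qN0 D0.
all: have r2 : r ^+ 2 = 1 - q ^+ 2 by rewrite q2; ring.
(* First the identities valid for all [xi] and [eta], as are those of the middle and inner patches,
   whose products are affine and vanish at the three corners. The others use the equation of the
   edge. *)
all: try by field: s2 r2.
all: have DE : 1 - sigma ^+ 2 * r ^+ 2 = 1 - r ^+ 2 + c ^+ 2 * r ^+ 2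
  by rewrite s2; ring.
all: rewrite DE in D0 *.
all: case: seam => [/eqP|->|->]; first rewrite subr_eq0 => /eqP <-.
all: by field: s2 q2; rewrite exprMn D0 qN0.
Qed.

(** * Barycentric coordinates along an edge *)

(** The corners of the parameter triangle, named after the indices of their control points. *)
Variant slot := S002 | S020 | S200.

Definition slot_bary {R : realType} (xi eta : R) (i : slot) : R :=
  match i with S002 => 1 - xi - eta | S020 => eta | S200 => xi end.

Definition slot_get {X : Type} (s : X * X * X) (i : slot) : X :=
  match i with S002 => s.1.1 | S020 => s.1.2 | S200 => s.2 end.

Definition site_triangle {R : realType} (r rho : R) (s : site R * site R * site R) :
    triangle R :=
  Triangle (site_point r rho s.1.1) (site_point r rho s.1.2) (site_point r rho s.2).

(** The plane of the polygon misses the origin, so the corners of a nondegenerate triangle in it are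
    linearly independent vectors, and barycentric coordinates can be read off triple products. *)
Lemma base_sites_indep (R : realType) (c sigma r rho : R) (m : patch_kind) :
  0 < c -> 0 < sigma -> c ^+ 2 + sigma ^+ 2 = 1 -> 0 < r < 1 -> 0 < rho < c * r ->
  let T := site_triangle r rho (base_sites c sigma m) in
  dot (cross (v002 T) (v020 T)) (v200 T) != 0.
Proof.
move=> c0 s0 cs /andP[r0 r1] /andP[x0 x1cr].
have q0 : 0 < Num.sqrt (1 - r ^+ 2) by rewrite sqrtr_gt0; nra.
have s2 : sigma ^+ 2 = 1 - c ^+ 2 by lra.
case: m; rewrite /= dotE /cross !coordE.
- rewrite (_ : _ + _ = - (2 * r * sigma * Num.sqrt (1 - r ^+ 2) * (r * c - rho))); last first.
    by ring: s2.
  by rewrite oppr_eq0 lt0r_neq0// !mulr_gt0// subr_gt0 mulrC.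
- rewrite (_ : _ + _ = 2 * rho * sigma * Num.sqrt (1 - r ^+ 2) * (r - rho * c)); last first.
    by ring: s2.
  by rewrite lt0r_neq0// !mulr_gt0// subr_gt0; nra.
- rewrite (_ : _ + _ = - (2 * rho ^+ 2 * sigma * c * Num.sqrt (1 - r ^+ 2))); last first.
    by ring: s2.
  by rewrite oppr_eq0 lt0r_neq0// !mulr_gt0.
Qed.

Lemma bary_unique (R : realType) (T : triangle R) (xi eta al be ga : R) :
  dot (cross (v002 T) (v020 T)) (v200 T) != 0 ->
  tri_point T xi eta = al *: v002 T + be *: v020 T + ga *: v200 T ->
  [/\ 1 - xi - eta = al, eta = be & xi = ga].
Proof.
case: T => a b d /= T0; rewrite /tri_point /= => e.
(* Pairing with the cross product of two corners isolates the coefficient of the third. *)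
have key (w : pt R) : dot w (xi *: d + eta *: b + (1 - xi - eta) *: a)
    = dot w (al *: a + be *: b + ga *: d) by rewrite e.
have := key (cross b d); have := key (cross d a); have := key (cross a b).
move: T0; rewrite !dotE /cross !coordE; set k := _ + _ => k0 e1 e2 e3.
split; apply: (mulfI k0); apply: subr0_eq; rewrite /k.
- by move/eqP: e3; rewrite -subr_eq0 => /eqP <-; ring.
- by move/eqP: e2; rewrite -subr_eq0 => /eqP <-; ring.
- by move/eqP: e1; rewrite -subr_eq0 => /eqP <-; ring.
Qed.

(** The first row of the match is the case [k = i], the second the case [k = j]; the remaining
    corner gets the coordinate 0. *)
Lemma slot_bary_edge (R : realType) (r rho : R) (s : site R * site R * site R)
    (i j : slot) (xi eta l : R) :
  let T := site_triangle r rho s in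
  dot (cross (v002 T) (v020 T)) (v200 T) != 0 -> i <> j ->
  tri_point T xi eta =
    (1 - l) *: site_point r rho (slot_get s i) + l *: site_point r rho (slot_get s j) ->
  slot_bary xi eta = fun k => match i, j, k with
    | S002, _, S002 | S020, _, S020 | S200, _, S200 => 1 - l
    | _, S002, S002 | _, S020, S020 | _, S200, S200 => l
    | _, _, _ => 0
    end.
Proof.
move=> T T0 ij e; set f := (X in _ = X).
have [e1 e2 e3] : [/\ 1 - xi - eta = f S002, eta = f S020 & xi = f S200].
  apply: (bary_unique T0); rewrite e /f.
  by case: i j ij {e f} => -[] //= _; apply: pt_eqP; rewrite !coordE; ring.
by apply/funext => -[].
Qed.

Lemma base_sites_edge (R : realType) (c sigma r x1 rho xi eta l : R)
    (m : patch_kind) (i j : slot) :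
  0 < c -> 0 < sigma -> c ^+ 2 + sigma ^+ 2 = 1 -> 0 < r < 1 -> 0 < rho < c * r ->
  i <> j ->
  let S := base_sites c sigma m in
  let b := bezier (site_net c r x1 S) in
  let s := slot_get S i in
  let t := slot_get S j in
  tri_point (site_triangle r rho S) xi eta =
    (1 - l) *: site_point r rho s + l *: site_point r rho t ->
  [/\ b xi eta = site_curve c r x1 s t l,
      dot (d_xi b xi eta) (site_normal c r s t l) = 0
    & dot (d_eta b xi eta) (site_normal c r s t l) = 0].
Proof.
move=> c0 s0 cs r01 rho0 ij S b s t.
move=> /(slot_bary_edge (base_sites_indep m c0 s0 cs r01 rho0) ij) bary.
have e1 := congr1 (fun f => f S002) bary.
have e2 := congr1 (fun f => f S020) bary.
have e3 := congr1 (fun f => f S200) bary.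
rewrite /= in e1 e2 e3.
have seam : [\/ 1 - xi - eta = 0, eta = 0 | xi = 0].
  rewrite e1 e2 e3; case: (i) (j) ij => -[] // _;
    by [constructor 1|constructor 2|constructor 3].
have := base_sites_seam x1 m r01 c0 s0 cs seam; rewrite -/S -/b.
have -> : b xi eta = site_curve c r x1 s t l.
  rewrite /b bezierE /site_curve /s /t /site_net.
  case: (S) => -[s002 s020] s200.
  (* The edge may be traversed in either direction, whence the symmetry of [site_mid]. *)
  move: e1 e2 e3; case: (i) (j) ij => -[] //= _ -> -> ->;
    rewrite ?[site_mid _ _ _ s020 s002]site_mid_sym
      ?[site_mid _ _ _ s200 s002]site_mid_sym ?[site_mid _ _ _ s200 s020]site_mid_sym;
    by apply: pt_eqP; rewrite !coordE; ring.
suff -> : site_normal c r s t l = (1 - xi - eta) *: site_point r (c * r) S.1.1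
    + eta *: site_point r (c * r) S.1.2 + xi *: site_point r (c * r) S.2.
  by case.
rewrite e1 e2 e3 /site_normal /s /t.
by case: (i) (j) ij => -[] // _ /=; apply: pt_eqP; rewrite !coordE; ring.
Qed.

(** * Rotations about the axis and injectivity of sites *)

Definition rotz_mx {R : realType} (theta : R) : 'M[R]_3 :=
  \matrix_(i < 3) [:: mkpt (cos theta) (sin theta) 0;
                      mkpt (- sin theta) (cos theta) 0; mkpt 0 0 1]`_i.

Lemma rotzE (R : realType) (theta : R) (p : pt R) : rotz theta p = p *m rotz_mx theta.
Proof.
rewrite mulmx_sum_row; under eq_bigr do rewrite rowK.
have -> : p = mkpt (px p) (py p) (pz p) by apply: pt_eqP; rewrite coordE.
rewrite !big_ord_recl big_ord0 /= !mxE /=.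
by apply: pt_eqP; rewrite !coordE; ring.
Qed.

Lemma rotz_mx_orth (R : realType) (theta : R) :
  rotz_mx theta *m (rotz_mx theta)^T = 1%:M.
Proof.
have cs := cos2Dsin2 theta.
apply/matrixP => i j; transitivity (dot (row i (rotz_mx theta)) (row j (rotz_mx theta))).
  by rewrite !mxE; apply: eq_bigr => k _; rewrite !mxE.
rewrite !rowK dotE mxE -val_eqE /=.
case: i j => [[|[|[|//]]] ?] [[|[|[|//]]] ?]; rewrite /= !coordE; try ring.
- by rewrite -cs; ring.
- by rewrite -cs; ring.
Qed.

Definition site_rot {R : realType} (theta : R) (s : site R) : site R :=
  match s with
  | SiteV u v => SiteV (cos theta * u - sin theta * v) (sin theta * u + cos theta * v)
  | SiteW u v => SiteW (cos theta * u - sin theta * v) (sin theta * u + cos theta * v)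
  | SiteC => SiteC
  end.

Lemma site_point_rot (R : realType) (r rho theta : R) (s : site R) :
  site_point r rho (site_rot theta s) = rotz theta (site_point r rho s).
Proof. by case: s => [u v|u v|]; apply: pt_eqP; rewrite /= !coordE; ring. Qed.

Lemma site_node_rot (R : realType) (c r x1 theta : R) (s : site R) :
  site_node c r x1 (site_rot theta s) = rotz theta (site_node c r x1 s).
Proof. by case: s => [u v|u v|]; apply: pt_eqP; rewrite /= !coordE; ring. Qed.

Lemma site_mid_rot (R : realType) (c r x1 theta : R) (s t : site R) :
  site_mid c r x1 (site_rot theta s) (site_rot theta t) =
  rotz theta (site_mid c r x1 s t).
Proof.
rewrite /site_mid !site_node_rot.
set w := site_node c r x1 s + _; set w' := rotz _ _ + _.
have -> : w' = rotz theta w by rewrite /w /w' !rotzE mulmxDl.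
have -> : dot (rotz theta w) (rotz theta w) = dot w w.
  by rewrite !rotzE dot_mulmx// rotz_mx_orth.
by case: s {w'} @w => [u v|u v|]; case: t => [u' v'|u' v'|] w;
  apply: pt_eqP; rewrite /rotz !coordE; ring.
Qed.

Lemma site_curve_rot (R : realType) (c r x1 theta l : R) (s t : site R) :
  site_curve c r x1 (site_rot theta s) (site_rot theta t) l =
  rotz theta (site_curve c r x1 s t l).
Proof.
by rewrite /site_curve !site_node_rot site_mid_rot !rotzE !mulmxDl -!scalemxAl.
Qed.

Lemma site_normal_rot (R : realType) (c r theta l : R) (s t : site R) :
  site_normal c r (site_rot theta s) (site_rot theta t) l =
  rotz theta (site_normal c r s t l).
Proof. by rewrite /site_normal !site_point_rot !rotzE !mulmxDl -!scalemxAl. Qed.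

Definition site_unit {R : realType} (s : site R) : Prop :=
  match s with
  | SiteV u v | SiteW u v => u ^+ 2 + v ^+ 2 = 1
  | SiteC => True
  end.

Lemma site_unit_rot (R : realType) (theta : R) (s : site R) :
  site_unit s -> site_unit (site_rot theta s).
Proof.
have cs := cos2Dsin2 theta.
(* Multiplicativity of sums of two squares, with 1 written as $1\cdot 1$. *)
case: s => [u v|u v|] //= uv; rewrite -(mulr1 1) -{1}cs -uv; ring.
Qed.

Lemma base_sites_unit (R : realType) (c sigma : R) (m : patch_kind) (i : slot) :
  c ^+ 2 + sigma ^+ 2 = 1 -> site_unit (slot_get (base_sites c sigma m) i).
Proof.
move=> cs; have s2 : sigma ^+ 2 = 1 - c ^+ 2 by lra.
by case: m; case: i => //=; ring: s2.
Qed.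

(** The distance from the axis is [r], [rho] or 0 and so determines the kind of the site; the
    direction is then obtained by cancelling the radius. *)
Lemma site_point_inj (R : realType) (r rho : R) (s t : site R) :
  0 < rho < r -> site_unit s -> site_unit t ->
  site_point r rho s = site_point r rho t -> s = t.
Proof.
move=> /andP[rho0 rhor] us ut e.
have ex := congr1 px e; have ey := congr1 py e.
have r0 : 0 < r := lt_trans rho0 rhor.
case: s us {e} ex ey => [u v|u v|]; case: t ut => [u' v'|u' v'|] //=;
  rewrite !coordE => h h' ex ey.
- by rewrite (mulfI (lt0r_neq0 r0) ex) (mulfI (lt0r_neq0 r0) ey).
- exfalso; have : r ^+ 2 = rho ^+ 2
    by rewrite -[LHS]mulr1 -h' -[RHS]mulr1 -h !mulrDr -!exprMn ex ey.
  by move/eqP; rewrite eqrXn2 ?(ltW r0) ?(ltW rho0)// gt_eqF.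
- exfalso; have : r ^+ 2 = 0
    by rewrite -[LHS]mulr1 -h' mulrDr -!exprMn ex ey expr0n addr0.
  by move/eqP; rewrite sqrf_eq0 gt_eqF.
- exfalso; have : rho ^+ 2 = r ^+ 2
    by rewrite -[LHS]mulr1 -h' -[RHS]mulr1 -h !mulrDr -!exprMn ex ey.
  by move/eqP; rewrite eqrXn2 ?(ltW r0) ?(ltW rho0)// lt_eqF.
- by rewrite (mulfI (lt0r_neq0 rho0) ex) (mulfI (lt0r_neq0 rho0) ey).
- exfalso; have : rho ^+ 2 = 0
    by rewrite -[LHS]mulr1 -h' mulrDr -!exprMn ex ey expr0n addr0.
  by move/eqP; rewrite sqrf_eq0 gt_eqF.
- exfalso; have : r ^+ 2 = 0
    by rewrite -[LHS]mulr1 -h mulrDr -!exprMn -ex -ey expr0n addr0.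
  by move/eqP; rewrite sqrf_eq0 gt_eqF.
- exfalso; have : rho ^+ 2 = 0
    by rewrite -[LHS]mulr1 -h mulrDr -!exprMn -ex -ey expr0n addr0.
  by move/eqP; rewrite sqrf_eq0 gt_eqF.
Qed.

(** * Triangles and patches of one face *)

Definition face_sites {R : realType} (n : nat) (m : patch_kind) (k : nat) :
    site R * site R * site R :=
  let S := base_sites (cos (pi / n%:R)) (sin (pi / n%:R)) m in
  let rot := site_rot (2 * pi * k%:R / n%:R) in
  (rot S.1.1, rot S.1.2, rot S.2).

Lemma cos_pi_div_gt0 (R : realType) (n : nat) :
  (3 <= n)%N -> 0 < cos (pi / n%:R :> R).
Proof.
move=> n3; apply: cos_gt0_pihalf.
have p0 := pi_gt0 R.
have n0 : 0 < n%:R :> R by rewrite ltr0n (leq_trans _ n3).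
rewrite (@lt_trans _ _ 0) ?oppr_lt0 ?divr_gt0//=.
by rewrite ltr_pM2l// ltf_pV2 ?posrE// ltr_nat.
Qed.

Lemma sin_pi_div_gt0 (R : realType) (n : nat) :
  (3 <= n)%N -> 0 < sin (pi / n%:R :> R).
Proof.
move=> n3; apply: sin_gt0_pi.
have p0 := pi_gt0 R.
have n0 : 0 < n%:R :> R by rewrite ltr0n (leq_trans _ n3).
by rewrite divr_gt0//= ltr_pdivrMr// ltr_pMr// ltr1n (leq_trans _ n3).
Qed.

(** Needed because the index [k + n.-1] of the preceding vertex may exceed [n.-1]. *)
Lemma polyV_mod (R : realType) (n : nat) (r : R) (j : nat) :
  (0 < n)%N -> polyV n r j = polyV n r (j %% n).
Proof.
move=> n0; have nN0 : n%:R != 0 :> R by rewrite pnatr_eq0 -lt0n.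
rewrite /polyV.
have -> : (2 * j + 1)%:R * pi / n%:R =
    (2 * (j %% n) + 1)%:R * pi / n%:R + (pi *+ 2) *+ (j %/ n) :> R.
  rewrite {1}(divn_eq j n) -[_ *+ (j %/ n)]mulr_natr -[pi *+ 2]mulr_natr.
  by rewrite !(natrD, natrM); field.
by rewrite (periodicn (@cosD2pi R)) (periodicn (@sinD2pi R)).
Qed.

Lemma polyV_rot (R : realType) (n : nat) (r rho : R) (k : nat) :
  polyV n r k = site_point r rho (site_rot (2 * pi * k%:R / n%:R)
    (SiteV (cos (pi / n%:R)) (sin (pi / n%:R)))).
Proof.
rewrite /polyV (_ : _ * _ / _ = 2 * pi * k%:R / n%:R + pi / n%:R).
  by rewrite cosD sinD.
by rewrite !(natrD, natrM) -mulrDl; congr (_ / _); ring.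
Qed.

Lemma polyV_pred_rot (R : realType) (n : nat) (r rho : R) (k : nat) :
  (0 < n)%N ->
  polyV n r (k + n.-1) = site_point r rho (site_rot (2 * pi * k%:R / n%:R)
    (SiteV (cos (pi / n%:R)) (- sin (pi / n%:R)))).
Proof.
case: n => // n _; have nN0 : n.+1%:R != 0 :> R by rewrite pnatr_eq0.
rewrite /polyV /= (_ : _ * _ / _ = 2 * pi * k%:R / n.+1%:R - pi / n.+1%:R + pi *+ 2).
  rewrite cosD2pi sinD2pi cosB sinB.
  by congr mkpt; ring.
rewrite -[pi *+ 2]mulr_natr; move: nN0.
by rewrite !(natrD, natrM) -(addn1 n) natrD => nN0; field.
Qed.

Lemma polyW_rot (R : realType) (n : nat) (r rho : R) (k : nat) :
  polyW n r rho k = site_point r rho (site_rot (2 * pi * k%:R / n%:R) (SiteW 1 0)).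
Proof.
rewrite /polyW /= (_ : _ * _ / _ = 2 * pi * k%:R / n%:R).
  by congr mkpt; ring.
by rewrite !(natrD, natrM); congr (_ / _); ring.
Qed.

Lemma polyW_pred_rot (R : realType) (n : nat) (r rho : R) (k : nat) :
  (0 < n)%N ->
  let c := cos (pi / n%:R) in let sigma := sin (pi / n%:R) in
  polyW n r rho (k + n.-1) = site_point r rho (site_rot (2 * pi * k%:R / n%:R)
    (SiteW (c ^+ 2 - sigma ^+ 2) (- (2 * c * sigma)))).
Proof.
case: n => // n _; have nN0 : n.+1%:R != 0 :> R by rewrite pnatr_eq0.
(* Writing $\frac{2\pi}{n}$ as a sum lets the addition formulas produce the coordinates in
   [base_sites]; the full turn comes from using [k + n.-1] for $k-1$. *)
rewrite /polyW /= (_ : _ * _ / _ =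
    2 * pi * k%:R / n.+1%:R - (pi / n.+1%:R + pi / n.+1%:R) + pi *+ 2).
  rewrite cosD2pi sinD2pi cosB sinB (cosD (pi / _)) (sinD (pi / _)).
  by congr mkpt; ring.
rewrite -[pi *+ 2]mulr_natr; move: nN0.
by rewrite !(natrD, natrM) -(addn1 n) natrD => nN0; field.
Qed.

Lemma ref_triangle_sites (R : realType) (n : nat) (r rho : R) (m : patch_kind)
    (k : nat) :
  (0 < n)%N -> ref_triangle n r rho m k = site_triangle r rho (face_sites n m k).
Proof.
move=> n0; case: m; rewrite /ref_triangle /site_triangle /=.
- by rewrite (polyV_pred_rot r rho)// (polyV_rot n r rho) polyW_rot.
- by rewrite (polyV_pred_rot r rho)// polyW_pred_rot// polyW_rot.
- by rewrite polyW_pred_rot// polyW_rot.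
Qed.

Lemma patch_sites (R : realType) (n : nat) (r x1 : R) (m : patch_kind) (k : nat) :
  (3 <= n)%N -> 0 < r < 1 ->
  Defs.patch n r x1 m k = fun xi eta =>
    bezier (site_net (cos (pi / n%:R)) r x1
      (base_sites (cos (pi / n%:R)) (sin (pi / n%:R)) m)) xi eta
    *m rotz_mx (2 * pi * k%:R / n%:R).
Proof.
move=> n3 r01; apply/funext => xi; apply/funext => eta.
rewrite /Defs.patch rotzE; congr (bezier _ _ _ *m _); apply: base_net_sites => //.
- exact: cos_pi_div_gt0.
- exact: sin_pi_div_gt0.
- exact: cos2Dsin2.
Qed.

Lemma slot_get_face_sites (R : realType) (n : nat) (m : patch_kind) (k : nat) (i : slot) :
  slot_get (@face_sites R n m k) i = site_rot (2 * pi * k%:R / n%:R)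
    (slot_get (base_sites (cos (pi / n%:R)) (sin (pi / n%:R)) m) i).
Proof. by case: i. Qed.

Lemma mulmx_orthM (R : realType) (B A : 'M[R]_3) :
  B *m B^T = 1%:M -> A *m A^T = 1%:M -> (B *m A) *m (B *m A)^T = 1%:M.
Proof. by move=> BB AA; rewrite trmx_mul mulmxA -(mulmxA B) AA mulmx1. Qed.

Lemma moved_patch_regular (R : realType) (n : nat) (r x1 : R) (A : 'M[R]_3)
    (m : patch_kind) (k : nat) :
  (3 <= n)%N -> 0 < r < 1 -> 0 < x1 < cos (pi / n%:R) * r -> A *m A^T = 1%:M ->
  regular_patch (fun xi eta => Defs.patch n r x1 m k xi eta *m A).
Proof.
move=> n3 r01 x1r AA xi eta D.
rewrite patch_sites//; under [X in d_xi X]eq_fun2 do rewrite -mulmxA.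
under [X in d_eta X]eq_fun2 do rewrite -mulmxA.
rewrite d_xi_mulmx d_eta_mulmx cross_mulmx_neq0//.
  by apply: mulmx_orthM => //; exact: rotz_mx_orth.
apply: base_sites_regular => //.
- exact: cos_pi_div_gt0.
- exact: sin_pi_div_gt0.
- exact: cos2Dsin2.
Qed.

Lemma moved_patch_quadratic (R : realType) (n : nat) (r x1 : R) (A : 'M[R]_3)
    (m : patch_kind) (k : nat) :
  (3 <= n)%N -> 0 < r < 1 ->
  quadratic_patch (fun xi eta => Defs.patch n r x1 m k xi eta *m A).
Proof.
move=> n3 r01; rewrite patch_sites//; eexists.
by apply/funext => xi; apply/funext => eta; rewrite -mulmxA bezier_mulmx.
Qed.

(** The rotation about the axis followed by [A] is one orthogonal matrix. Sites, curves and normals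
    are equivariant, so everything is pulled back to the base patch. *)
Lemma moved_patch_edge (R : realType) (n : nat) (r x1 rho xi eta l : R)
    (A : 'M[R]_3) (m : patch_kind) (k : nat) (i j : slot) :
  (3 <= n)%N -> 0 < r < 1 -> 0 < rho < cos (pi / n%:R) * r -> A *m A^T = 1%:M ->
  i <> j ->
  let s := slot_get (face_sites n m k) i in
  let t := slot_get (face_sites n m k) j in
  let c := cos (pi / n%:R) in
  let p := fun xi eta => Defs.patch n r x1 m k xi eta *m A in
  tri_point (move_triangle A (ref_triangle n r rho m k)) xi eta =
    (1 - l) *: (site_point r rho s *m A) + l *: (site_point r rho t *m A) ->
  [/\ p xi eta = site_curve c r x1 s t l *m A,
      dot (d_xi p xi eta) (site_normal c r s t l *m A) = 0
    & dot (d_eta p xi eta) (site_normal c r s t l *m A) = 0].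
Proof.
move=> n3 r01 rhor AA ij s t c p; pose phi : R := 2 * pi * k%:R / n%:R.
have n0 : (0 < n)%N by exact: leq_trans n3.
have BB : (rotz_mx phi *m A) *m (rotz_mx phi *m A)^T = 1%:M.
  by apply: mulmx_orthM => //; exact: rotz_mx_orth.
have c0 : 0 < c by exact: cos_pi_div_gt0.
have s0 : 0 < sin (pi / n%:R :> R) by exact: sin_pi_div_gt0.
have cs : c ^+ 2 + sin (pi / n%:R) ^+ 2 = 1 by exact: cos2Dsin2.
have -> : p = fun xi eta => bezier (site_net c r x1 (base_sites c (sin (pi / n%:R)) m))
    xi eta *m (rotz_mx phi *m A).
  by rewrite /p patch_sites//; apply/funext => x; apply/funext => y; rewrite -mulmxA.
rewrite d_xi_mulmx d_eta_mulmx {p}.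
rewrite ref_triangle_sites// /s /t !slot_get_face_sites -/c -/phi.
rewrite site_curve_rot site_normal_rot !site_point_rot !rotzE -!mulmxA !dot_mulmx//.
have -> : tri_point (move_triangle A (site_triangle r rho (face_sites n m k))) xi eta =
    tri_point (site_triangle r rho (base_sites c (sin (pi / n%:R)) m)) xi eta
    *m (rotz_mx phi *m A).
  rewrite /tri_point /= !site_point_rot !rotzE -/phi -!mulmxA.
  by rewrite !mulmxDl -!scalemxAl.
rewrite 2!scalemxAl -mulmxDl => /(mulmx_orth_inj BB) e.
by have [-> -> ->] := base_sites_edge x1 c0 s0 cs r01 rhor ij e.
Qed.

(** * Interior points of faces *)

Lemma conv_hull_vertex (R : realType) (m : nat) (v : 'I_m -> pt R) (i : 'I_m) :
  conv_hull v (v i).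
Proof.
exists (fun j => (j == i)%:R); split.
- by move=> j; rewrite ler0n.
- by rewrite (bigD1 i)//= eqxx big1 ?addr0// => j /negPf ->.
- by rewrite (bigD1 i)//= eqxx scale1r big1 ?addr0// => j /negPf ->; rewrite scale0r.
Qed.

Lemma conv_hull_convex (R : realType) (m : nat) (v : 'I_m -> pt R) (p q : pt R) (t : R) :
  conv_hull v p -> conv_hull v q -> 0 <= t <= 1 ->
  conv_hull v ((1 - t) *: p + t *: q).
Proof.
move=> [w [w0 w1 ->]] [w' [w'0 w'1 ->]] /andP[t0 t1].
exists (fun i => (1 - t) * w i + t * w' i); split.
- by move=> i; rewrite addr_ge0// mulr_ge0// subr_ge0.
- by rewrite big_split/= -!mulr_sumr w1 w'1 !mulr1 subrK.
- rewrite !scaler_sumr -big_split/=; apply: eq_bigr => i _.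
  by rewrite !scalerA -scalerDl.
Qed.

Lemma polyV_hull (R : realType) (n : nat) (r : R) (j : nat) :
  (0 < n)%N -> reference_polygon n r (polyV n r j).
Proof.
move=> n0; rewrite polyV_mod//.
exact: (@conv_hull_vertex _ _ (fun k : 'I_n => polyV n r k)
  (Ordinal (ltn_pmod j n0))).
Qed.

(* 2 sin (pi / n) cos ((2k + 1) pi / n) = sin ((2k + 2) pi / n) - sin (2k pi / n),
   and likewise for the sines, so that the sums telescope. *)
Lemma polyC_mean (R : realType) (n : nat) (r : R) :
  (3 <= n)%N -> Defs.polyC r = \sum_(k < n) n%:R^-1 *: polyV n r k.
Proof.
move=> n3; have n0 : n%:R != 0 :> R by rewrite pnatr_eq0 -lt0n (leq_trans _ n3).
have s0 := lt0r_neq0 (sin_pi_div_gt0 R n3).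
have angle (k : nat) : (2 * k + 1)%:R * pi / n%:R = k%:R * (pi *+ 2) / n%:R + pi / n%:R :> R.
  by rewrite !(natrD, natrM) -[pi *+ 2]mulr_natr -mulrDl; congr (_ / _); ring.
have angleS (k : nat) :
    k.+1%:R * (pi *+ 2) / n%:R = k%:R * (pi *+ 2) / n%:R + pi / n%:R + pi / n%:R :> R.
  by rewrite -(addn1 k) natrD -[pi *+ 2]mulr_natr -!mulrDl; congr (_ / _); ring.
pose F (k : nat) : R := sin (k%:R * (pi *+ 2) / n%:R) / (2 * sin (pi / n%:R)).
pose G (k : nat) : R := - cos (k%:R * (pi *+ 2) / n%:R) / (2 * sin (pi / n%:R)).
have Fn : \sum_(k < n) cos ((2 * k + 1)%:R * pi / n%:R) = 0 :> R.
  transitivity (\sum_(0 <= k < n) (F k.+1 - F k)).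
    rewrite big_mkord; apply: eq_bigr => k _.
    rewrite /F angle angleS -addrA !(sinD (_ * _ / _)) !cosD sinD.
    apply: (mulIf s0); rewrite -mulrBl invfM mulrA mulfVK//.
    have := cos2Dsin2 (pi / n%:R : R).
    set c := cos (pi / _); set s := sin (pi / _) => cs.
    have c2 : c ^+ 2 = 1 - s ^+ 2 by rewrite -cs; ring.
    by field: c2.
  rewrite telescope_sumr// /F mulr0n !mul0r sin0 mul0r subr0.
  by rewrite mulrAC divff// mul1r sin2pi mul0r.
have Gn : \sum_(k < n) sin ((2 * k + 1)%:R * pi / n%:R) = 0 :> R.
  transitivity (\sum_(0 <= k < n) (G k.+1 - G k)).
    rewrite big_mkord; apply: eq_bigr => k _.
    rewrite /G angle angleS -addrA !(cosD (_ * _ / _)) !sinD cosD.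
    apply: (mulIf s0); rewrite -mulrBl invfM mulrA mulfVK//.
    have := cos2Dsin2 (pi / n%:R : R).
    set c := cos (pi / _); set s := sin (pi / _) => cs.
    have c2 : c ^+ 2 = 1 - s ^+ 2 by rewrite -cs; ring.
    by field: c2.
  rewrite telescope_sumr// /G mulr0n !mul0r cos0.
  by rewrite mulrAC divff// mul1r cos2pi subrr.
have sumE (f : pt R -> R) (g : 'I_n -> pt R) :
    f 0 = 0 -> {morph f : x y / x + y} -> f (\sum_(k < n) g k) = \sum_(k < n) f (g k).
  by move=> f0 fD; elim/big_rec2: _ => // i x y _ <-.
apply: pt_eqP; rewrite sumE ?coordE//; try (by move=> x y; rewrite coordE).
- under eq_bigr do rewrite !coordE mulrCA.
  by rewrite -mulr_sumr -mulr_sumr Fn !mulr0.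
- under eq_bigr do rewrite !coordE mulrCA.
  by rewrite -mulr_sumr -mulr_sumr Gn !mulr0.
- under eq_bigr do rewrite !coordE.
  by rewrite sumr_const card_ord -mulrnAl -[n%:R^-1 *+ n]mulr_natr mulVf// mul1r.
Qed.

(** The midpoint of the side next to W lies in the direction of W at distance $cr$ from C, so W
    divides the segment from C to it in the ratio given by $\rho/(cr)$. *)
Lemma polyW_convex (R : realType) (n : nat) (r rho : R) (k : nat) :
  (3 <= n)%N -> r != 0 ->
  polyW n r rho k = (1 - rho / (cos (pi / n%:R) * r)) *: Defs.polyC r
    + (rho / (cos (pi / n%:R) * r)) *:
      ((1 - 2^-1) *: polyV n r k + 2^-1 *: polyV n r (k + n.-1)).
Proof.
move=> n3 r0; have c0 := lt0r_neq0 (cos_pi_div_gt0 R n3).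
rewrite (polyV_pred_rot r rho) ?(leq_trans _ n3)// (polyV_rot n r rho) polyW_rot.
by apply: pt_eqP; rewrite /= !coordE; field; rewrite r0 c0.
Qed.

Lemma polyC_hull (R : realType) (n : nat) (r : R) :
  (3 <= n)%N -> reference_polygon n r (Defs.polyC r).
Proof.
move=> n3; exists (fun=> n%:R^-1); split.
- by move=> i; rewrite invr_ge0 ler0n.
- rewrite sumr_const card_ord -[_ *+ n]mulr_natr mulVf//.
  by rewrite pnatr_eq0 -lt0n (leq_trans _ n3).
- exact: polyC_mean.
Qed.

Lemma polyW_hull (R : realType) (n : nat) (r rho : R) (k : nat) :
  (3 <= n)%N -> 0 < r -> 0 < rho < cos (pi / n%:R) * r ->
  reference_polygon n r (polyW n r rho k).
Proof.
move=> n3 r0 /andP[rho0 rhor]; have n0 : (0 < n)%N by exact: leq_trans n3.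
have cr0 : 0 < cos (pi / n%:R) * r by exact: lt_trans rhor.
rewrite polyW_convex ?lt0r_neq0//; apply: conv_hull_convex.
- exact: polyC_hull.
- apply: conv_hull_convex; [exact: polyV_hull|exact: polyV_hull|lra].
- by rewrite divr_ge0 ?(ltW rho0) ?(ltW cr0)//= ler_pdivrMr// mul1r ltW.
Qed.

Lemma corners_hull (R : realType) (n : nat) (r rho : R) (m : patch_kind) (k : nat)
    (a : pt R) :
  (3 <= n)%N -> 0 < r -> 0 < rho < cos (pi / n%:R) * r ->
  a \in corners (ref_triangle n r rho m k) -> reference_polygon n r a.
Proof.
move=> n3 r0 rhor; have n0 : (0 < n)%N by exact: leq_trans n3.
have V j := polyV_hull r j n0.
have W j := polyW_hull j n3 r0 rhor.
have C := polyC_hull r n3.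
by case: m; rewrite !inE => /or3P[] /eqP -> /=; [exact: V|exact: W|exact: V|exact: V|exact: W|exact: W|exact: W|exact: W|exact: C].
Qed.

(* C and the points W lie in the relative interior of the polygon. *)
Lemma polyC_support (R : realType) (n : nat) (r h : R) (u : pt R) :
  (3 <= n)%N -> (forall j, dot u (polyV n r j) <= h) -> dot u (Defs.polyC r) = h ->
  forall j : 'I_n, dot u (polyV n r j) = h.
Proof.
move=> n3 uV uC j; have n0 : 0 < n%:R :> R by rewrite ltr0n (leq_trans _ n3).
(* The deficits of the vertices are nonnegative, and their mean is the deficit of C, which is
   zero. *)
have : \sum_(k < n) (h - dot u (polyV n r k)) = 0.
  apply: (mulfI (invr_neq0 (lt0r_neq0 n0))); rewrite mulr0 mulr_sumr.
  under eq_bigr do rewrite mulrBr.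
  rewrite sumrB sumr_const card_ord -mulrnAl -[_ *+ n]mulr_natr mulVf ?lt0r_neq0// mul1r.
  rewrite -uC (polyC_mean r n3) dot_sumr; apply/eqP; rewrite subr_eq0; apply/eqP.
  by apply: eq_bigr => k _; rewrite dotZr.
move/eqP; rewrite psumr_eq0 => [/allP/(_ j)|k _]; last by rewrite subr_ge0.
by rewrite mem_index_enum => /(_ isT); rewrite subr_eq0 => /eqP.
Qed.

(** W is a convex combination, with positive weight at C, of points at level at most [h]; hence C is
    at level [h] too. *)
Lemma polyW_support (R : realType) (n : nat) (r rho h : R) (u : pt R) (k : nat) :
  (3 <= n)%N -> 0 < r -> 0 < rho < cos (pi / n%:R) * r ->
  (forall j, dot u (polyV n r j) <= h) -> dot u (polyW n r rho k) = h ->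
  forall j : 'I_n, dot u (polyV n r j) = h.
Proof.
move=> n3 r0 /andP[rho0 rhor] uV uW; apply: polyC_support => //.
have cr0 : 0 < cos (pi / n%:R) * r by exact: lt_trans rhor.
have uC : dot u (Defs.polyC r) <= h.
  rewrite (polyC_mean r n3) dot_sumr.
  have -> : h = \sum_(i < n) n%:R^-1 * h.
    by rewrite sumr_const card_ord -mulrnAl -[_ *+ n]mulr_natr
      mulVf ?mul1r// pnatr_eq0 -lt0n (leq_trans _ n3).
  by apply: ler_sum => i _; rewrite dotZr ler_wpM2l ?invr_ge0.
move: uW; rewrite polyW_convex ?lt0r_neq0// !dotDr !dotZr !dotDr !dotZr.
set x := rho / _ => uW.
have x0 : 0 < x by rewrite divr_gt0.
have x1 : x < 1 by rewrite ltr_pdivrMr// mul1r.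
have := uV k; have := uV (k + n.-1)%N; move: uW uC.
set C := dot u _; set V := dot u _; set V' := dot u _ => uW uC hV' hV.
apply/eqP; rewrite eq_le uC /=; nra.
Qed.

Lemma dotC (R : realType) (u v : pt R) : dot u v = dot v u.
Proof. by rewrite !dotE; ring. Qed.

(** Three affinely independent points of [F] lie in both supporting planes, so these planes coincide
    and each face is the intersection of [P] with the same plane. *)
Lemma face_sub_eq (R : realType) (P F G : set (pt R)) :
  face P F -> face P G -> F `<=` G -> F = G.
Proof.
move=> [[u [h [u0 uP FE]]] [a [b [d [Fa Fb Fd abd]]]]].
move=> [[u' [h' [u'0 uP' GE]]] _] FG; apply/seteqP; split=> // p.
have inF x : F x -> dot u x = h by rewrite FE => -[].
have inG x : G x -> dot u' x = h' by rewrite GE => -[].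
move=> Gp; have Pp : P p by move: Gp; rewrite GE => -[].
have X0 := free_cross abd.
have uba : dot (b - a) u = 0 by rewrite dotC dotBr !inF// subrr.
have uda : dot (d - a) u = 0 by rewrite dotC dotBr !inF// subrr.
have u'ba : dot (b - a) u' = 0 by rewrite dotC dotBr !inG ?subrr//; exact: FG.
have u'da : dot (d - a) u' = 0 by rewrite dotC dotBr !inG ?subrr//; exact: FG.
have u'pa : dot (p - a) u' = 0 by rewrite dotC dotBr !inG ?subrr//; exact: FG.
(* The span is the common direction plane, described first as the complement of [u'], then as that
   of [u]. *)
have : p - a \in <<[:: b - a; d - a]>>%VS.
  by rewrite (span2_orthogonal _ u'0 X0 u'ba u'da) u'pa.
rewrite (span2_orthogonal _ u0 X0 uba uda) dotC dotBr subr_eq0 => /eqP upa.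
by rewrite FE; split=> //=; rewrite upa inF.
Qed.

Definition site_outer {R : realType} (s : site R) : bool :=
  if s is SiteV _ _ then true else false.

Lemma inner_site_support (R : realType) (n : nat) (r rho h : R) (u : pt R)
    (m : patch_kind) (k : nat) (i : slot) :
  (3 <= n)%N -> 0 < r -> 0 < rho < cos (pi / n%:R) * r ->
  let s := slot_get (face_sites n m k) i in
  ~~ site_outer s ->
  (forall j, dot u (polyV n r j) <= h) -> dot u (site_point r rho s) = h ->
  forall j : 'I_n, dot u (polyV n r j) = h.
Proof.
move=> n3 r0 rhor s sN uV; have n0 : (0 < n)%N by exact: leq_trans n3.
have W j := polyW_support n3 r0 rhor uV (k := j).
have C := polyC_support n3 uV.
rewrite /s slot_get_face_sites; move: sN; rewrite /s slot_get_face_sites.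
by case: m {s}; case: i => // _; rewrite /slot_get /base_sites;
  rewrite -?polyW_pred_rot// -?polyW_rot; first [exact: W|exact: C].
Qed.

(** The supporting plane of [G] touches [F] at a relatively interior point, hence contains all
    vertices of [F]; thus [F] is a subset of [G]. *)
Lemma inner_site_face (R : realType) (P F G : set (pt R)) (n : nat) (r rho : R)
    (A : 'M[R]_3) (m : patch_kind) (k : nat) (i : slot) :
  (3 <= n)%N -> 0 < r -> 0 < rho < cos (pi / n%:R) * r ->
  face P F -> face P G -> [set p *m A | p in reference_polygon n r] = F ->
  let s := slot_get (face_sites n m k) i in
  G (site_point r rho s *m A) -> ~~ site_outer s -> F = G.
Proof.
move=> n3 r0 rhor fF fG AF s Gs sN; apply: (face_sub_eq fF fG).
have n0 : (0 < n)%N by exact: leq_trans n3.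
case: (fF) => -[u' [h' [_ _ FE]]] _; have FP x : F x -> P x by rewrite FE => -[].
case: fG => -[u [h [_ uP GE]]] _.
have dotA p : dot u (p *m A) = dot (u *m A^T) p.
  by rewrite !dot_mxE trmx_mul mulmxA.
have uV (j : nat) : dot (u *m A^T) (polyV n r j) <= h.
  rewrite -dotA; apply: uP; apply: FP; rewrite -AF.
  by exists (polyV n r j) => //; exact: polyV_hull.
have us : dot (u *m A^T) (site_point r rho s) = h.
  by rewrite -dotA; move: Gs; rewrite GE => -[].
have uVj := inner_site_support n3 r0 rhor sN uV us.
move=> p Fp; rewrite GE; split; first exact: FP.
move: Fp; rewrite -AF => -[q [w [w0 w1 ->]] <-] /=.
rewrite dotA dot_sumr; under eq_bigr do rewrite dotZr uVj.
by rewrite -mulr_suml w1 mul1r.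
Qed.

(** * Agreement along common edges *)

(** Both tangent planes are the orthogonal complement of the common normal [N]. *)
Lemma tangent_plane_eq (R : realType) (p p' : R -> R -> pt R) (N : pt R)
    (xi eta xi' eta' : R) :
  N != 0 -> cross (d_xi p xi eta) (d_eta p xi eta) != 0 ->
  cross (d_xi p' xi' eta') (d_eta p' xi' eta') != 0 ->
  dot (d_xi p xi eta) N = 0 -> dot (d_eta p xi eta) N = 0 ->
  dot (d_xi p' xi' eta') N = 0 -> dot (d_eta p' xi' eta') N = 0 ->
  tangent_plane p xi eta = tangent_plane p' xi' eta'.
Proof.
move=> N0 X X' e1 e2 e1' e2'; apply/vspaceP => w.
by rewrite (span2_orthogonal w N0 X)// (span2_orthogonal w N0 X').
Qed.

(** Before the motion by [A], the normal is an affine combination of points at height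
    $\sqrt{1-r^2}>0$, so it has this height itself. *)
Lemma site_normal_neq0 (R : realType) (c r l : R) (A : 'M[R]_3) (s t : site R) :
  0 < r < 1 -> A *m A^T = 1%:M -> site_normal c r s t l *m A != 0.
Proof.
move=> /andP[r0 r1] AA; rewrite -(mul0mx _ A) (inj_eq (mulmx_orth_inj AA)).
apply/eqP => /(congr1 pz); rewrite /site_normal !coordE.
have zE s' : pz (site_point r (c * r) s') = Num.sqrt (1 - r ^+ 2).
  by case: s' => [? ?|? ?|]; rewrite coordE.
have : 0 < Num.sqrt (1 - r ^+ 2) by rewrite sqrtr_gt0; nra.
by rewrite !zE -mulrDl subrK mul1r => /lt0r_neq0/eqP.
Qed.

(* Over a side of the polygon the boundary curve and the normal field are
   determined by the end points, hence shared by the faces on both sides. *)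
Lemma outer_site_curve (R : realType) (c r rho x1 l : R) (A : 'M[R]_3) (s t : site R) :
  A *m A^T = 1%:M -> site_outer s -> site_outer t ->
  let a := site_point r rho s *m A in
  let b := site_point r rho t *m A in
  site_curve c r x1 s t l *m A = (1 - l) ^+ 2 *: a
    + (2 * l * (1 - l)) *: ((2 / dot (a + b) (a + b)) *: (a + b)) + l ^+ 2 *: b.
Proof.
move=> AA; case: s => // u v _; case: t => // u' v' _.
by rewrite /site_curve /= -!mulmxDl dot_mulmx// !mulmxDl -!scalemxAl !mulmxDl.
Qed.

Lemma outer_site_normal (R : realType) (c r rho l : R) (s t : site R) (A : 'M[R]_3) :
  site_outer s -> site_outer t ->
  site_normal c r s t l *m A =
  (1 - l) *: (site_point r rho s *m A) + l *: (site_point r rho t *m A).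
Proof.
by case: s => // u v _; case: t => // u' v' _; rewrite mulmxDl -!scalemxAl.
Qed.

Lemma moved_corner_site (R : realType) (n : nat) (r rho : R) (A : 'M[R]_3)
    (m : patch_kind) (k : nat) (a : pt R) :
  (0 < n)%N -> a \in corners (move_triangle A (ref_triangle n r rho m k)) ->
  exists i, a = site_point r rho (slot_get (face_sites n m k) i) *m A.
Proof.
move=> n0; rewrite ref_triangle_sites// !inE => /or3P[] /eqP ->.
- by exists S002.
- by exists S020.
- by exists S200.
Qed.

Lemma moved_corner_face (R : realType) (n : nat) (r rho : R) (A : 'M[R]_3)
    (m : patch_kind) (k : nat) (F : set (pt R)) (a : pt R) :
  (3 <= n)%N -> 0 < r -> 0 < rho < cos (pi / n%:R) * r ->
  [set p *m A | p in reference_polygon n r] = F ->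
  a \in corners (move_triangle A (ref_triangle n r rho m k)) -> F a.
Proof.
move=> n3 r0 rhor <-; have C := @corners_hull R n r rho m k _ n3 r0 rhor.
rewrite !inE => /or3P[] /eqP ->.
- by exists (v002 (ref_triangle n r rho m k)) => //; apply: C; rewrite !inE eqxx.
- by exists (v020 (ref_triangle n r rho m k)) => //; apply: C; rewrite !inE eqxx orbT.
- by exists (v200 (ref_triangle n r rho m k)) => //; apply: C; rewrite !inE eqxx !orbT.
Qed.

Lemma face_sites_unit (R : realType) (n : nat) (m : patch_kind) (k : nat) (i : slot) :
  site_unit (slot_get (@face_sites R n m k) i).
Proof.
rewrite slot_get_face_sites; apply: site_unit_rot; apply: base_sites_unit.
exact: cos2Dsin2.
Qed.

(** * Regularity and $G^1$ continuity of the whole spline *)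

Unset Implicit Arguments.
Set Strict Implicit.
Set Printing Implicit Defensive.

Theorem mainTheorem3 (R : realType) (P : set (pt R))
  (hP : convex_uniform_polyhedron P)
  (hS : inscribed_in_unit_sphere P)
  (n : set (pt R) -> nat) (r x1 : set (pt R) -> R)
  (hF : forall F, face P F -> regular_polygon (n F) (r F) F)
  (hr : forall F, face P F -> 0 < r F < 1)
  (hx1 : forall F, face P F -> 0 < x1 F < cos (pi / (n F)%:R) * r F)
  (A : set (pt R) -> 'M[R]_3)
  (hA : forall F, face P F -> rotation (A F))
  (hAF : forall F, face P F ->
     [set p *m A F | p in reference_polygon (n F) (r F)] = F)
  (rho : set (pt R) -> R)
  (hrho : forall F, face P F -> 0 < rho F < cos (pi / (n F)%:R) * r F) :
  [/\ forall s, patch_indices P n s -> regular_patch (poly_patch n r x1 A s),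
      forall s, patch_indices P n s -> quadratic_patch (poly_patch n r x1 A s)
    & G1_continuous (patch_indices P n)
        (poly_triangle n r rho A) (poly_patch n r x1 A)].
Proof.
have n3 F : face P F -> (3 <= n F)%N by move=> /hF[].
have AA F : face P F -> A F *m (A F)^T = 1%:M by move=> /hA[].
have regular s : patch_indices P n s -> regular_patch (poly_patch n r x1 A s).
  case: s => -[F m] k [fF _].
  exact: moved_patch_regular (n3 F fF) (hr F fF) (hx1 F fF) (AA F fF).
split=> //.
  by case=> -[F m] k [fF _]; exact: moved_patch_quadratic (n3 F fF) (hr F fF).
move=> s t hs ht a b ab; have reg_s := regular s hs; have reg_t := regular t ht.
case: s hs reg_s => -[F m] k [fF _] reg_s; case: t ht reg_t => -[G m'] k' [fG _] reg_t.
have nF := n3 F fF; have nG := n3 G fG.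
have rF0 : 0 < r F by have /andP[] := hr F fF.
have rG0 : 0 < r G by have /andP[] := hr G fG.
move=> aF bF aG bG l xi eta xi' eta' _ D D' /= e e'.
have Fa : F a := moved_corner_face nF rF0 (hrho F fF) (hAF F fF) aF.
have Fb : F b := moved_corner_face nF rF0 (hrho F fF) (hAF F fF) bF.
have Ga : G a := moved_corner_face nG rG0 (hrho G fG) (hAF G fG) aG.
have Gb : G b := moved_corner_face nG rG0 (hrho G fG) (hAF G fG) bG.
have [i ai] := moved_corner_site (ltnW (ltnW nF)) aF.
have [j bj] := moved_corner_site (ltnW (ltnW nF)) bF.
have [i' ai'] := moved_corner_site (ltnW (ltnW nG)) aG.
have [j' bj'] := moved_corner_site (ltnW (ltnW nG)) bG.
have ij : i <> j by move=> eij; move: ab; rewrite ai bj eij eqxx.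
have ij' : i' <> j' by move=> eij; move: ab; rewrite ai' bj' eij eqxx.
have eF := e; have eG := e'; rewrite ai bj in eF; rewrite ai' bj' in eG.
have [pF xF yF] := moved_patch_edge (x1 F) nF (hr F fF) (hrho F fF) (AA F fF) ij eF.
have [pG xG yG] := moved_patch_edge (x1 G) nG (hr G fG) (hrho G fG) (AA G fG) ij' eG.
have [FG|/eqP FG] := eqVneq F G.
  subst G.
  have rhoF : 0 < rho F < r F.
    have /andP[-> /lt_le_trans->//] := hrho F fF.
    by rewrite ger_pMl// cos_le1.
  (* Within one face equal corners come from equal sites, so both patches have the same curve and
     the same normal over the edge. *)
  have siteE : forall m1 m2 k1 k2 i1 i2,
      site_point (r F) (rho F) (slot_get (face_sites (n F) m1 k1) i1) *m A F =
      site_point (r F) (rho F) (slot_get (face_sites (n F) m2 k2) i2) *m A F ->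
      slot_get (@face_sites R (n F) m1 k1) i1 = slot_get (face_sites (n F) m2 k2) i2.
    move=> m1 m2 k1 k2 i1 i2 /(mulmx_orth_inj (AA F fF)).
    by apply: site_point_inj rhoF _ _; exact: face_sites_unit.
  have ii := siteE _ _ _ _ _ _ (etrans (esym ai') ai).
  have jj := siteE _ _ _ _ _ _ (etrans (esym bj') bj).
  rewrite ii jj in pG xG yG; split; first by rewrite pF pG.
  apply: (tangent_plane_eq _ (reg_s _ _ D) (reg_t _ _ D') xF yF xG yG).
  exact: site_normal_neq0 (hr F fF) (AA F fF).
(* A corner W or C of one face lying in another face would make the two faces equal; so distinct
   faces share only corners V. *)
have outer (F1 G1 : set (pt R)) m1 k1 i1 : face P F1 -> face P G1 -> F1 <> G1 ->
    G1 (site_point (r F1) (rho F1) (slot_get (face_sites (n F1) m1 k1) i1) *m A F1) ->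
    site_outer (slot_get (@face_sites R (n F1) m1 k1) i1).
  move=> fF1 fG1 FG1 Gs; apply/negPn/negP => sN; apply: FG1.
  have /andP[r0 _] := hr F1 fF1.
  exact: inner_site_face (n3 _ fF1) r0 (hrho _ fF1) fF1 fG1 (hAF _ fF1) Gs sN.
have oi : site_outer (slot_get (@face_sites R (n F) m k) i).
  by apply: outer fF fG FG _; rewrite -ai.
have oj : site_outer (slot_get (@face_sites R (n F) m k) j).
  by apply: outer fF fG FG _; rewrite -bj.
have oi' : site_outer (slot_get (@face_sites R (n G) m' k') i').
  by apply: outer fG fF (nesym FG) _; rewrite -ai'.
have oj' : site_outer (slot_get (@face_sites R (n G) m' k') j').
  by apply: outer fG fF (nesym FG) _; rewrite -bj'.
have NF0 := site_normal_neq0 (cos (pi / (n F)%:R))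
  l (slot_get (face_sites (n F) m k) i) (slot_get (face_sites (n F) m k) j)
  (hr F fF) (AA F fF).
(* Both normals become $(1-l)a+lb$, which no longer refers to either face. *)
rewrite (outer_site_normal _ _ (rho F) _ _ oi oj) -ai -bj in NF0 xF yF.
rewrite (outer_site_normal _ _ (rho G) _ _ oi' oj') -ai' -bj' in xG yG.
split; last exact: (tangent_plane_eq NF0 (reg_s _ _ D) (reg_t _ _ D') xF yF xG yG).
rewrite pF pG (outer_site_curve _ _ (rho F) _ _ (AA F fF) oi oj).
by rewrite (outer_site_curve _ _ (rho G) _ _ (AA G fG) oi' oj') -ai -bj -ai' -bj'.
Qed.
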